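(* Fix $1\le p<2$. There exist constants $c_p>0$ and $\kappa_p\ge 1$ depending only on $p$ such that for all integers $d\ge 1$ and $n\ge 1$, with $r=\lceil \exp(\exp(c_p d))\rceil$, there is an $\ell_p$ oblivious subspace embedding over $r\times n$ matrices with distortion at most $\kappa_p$. Specifically, if $\Pi$ has i.i.d. entries distributed as $(r\log r)^{-1/p}X$ with $X\sim\mathcal{D}_p$, then there are constants $0<a_p\le b_p$ (depending only on $p$, with $b_p/a_p\le\kappa_p$) such that for every fixed $A\in\mathbb{R}^{n\times d}$, with probability at least $0.99$, $a_p\|Ax\|_p\le\|\Pi Ax\|_p\le b_p\|Ax\|_p$ for all $x\in\mathbb{R}^d$.
   Context: $\mathcal{D}_p$ denotes the standard symmetric $p$-stable distribution: if $X_1,\dots,X_m$ are i.i.d. $\sim\mathcal{D}_p$ and $a\in\mathbb{R}^m$, then $\sum_i a_iX_i$ has the same distribution as $(\sum_i|a_i|^p)^{1/p}X$ with $X\sim\mathcal{D}_p$ ($\mathcal{D}_1$ is the standard Cauchy distribution). A distribution over $r\times n$ real matrices $\Pi$ is an $\ell_p$ oblivious subspace embedding (for $n\times d$ matrices) with distortion $\kappa$ if for every fixed $A\in\mathbb{R}^{n\times d}$, $\Pr_{\Pi}[\|Ax\|_p \le \|\Pi A x\|_p \le \kappa\|Ax\|_p \ \forall x\in\mathbb{R}^d] \ge 0.99$; rescaling $\Pi$ by a constant is allowed, so a two-sided bound $a\|Ax\|_p\le\|\Pi Ax\|_p\le b\|Ax\|_p$ gives distortion $b/a$. *)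

(* Defs.v *)
From HB Require Import structures.
From mathcomp Require Import all_boot all_order all_algebra.
From mathcomp Require Import all_classical all_reals all_analysis.
Set Implicit Arguments. Unset Strict Implicit. Unset Printing Implicit Defensive.
Import Order.TTheory GRing.Theory Num.Theory.
Import numFieldNormedType.Exports.
Local Open Scope classical_set_scope.
Local Open Scope ring_scope.

Definition lpnorm (R : realType) (p : R) (m : nat) (v : 'cV[R]_m) : R :=
  (\sum_(i < m) `|v i 0| `^ p) `^ (p^-1).

(* Standard symmetric p-stable law D_p on R: symmetric, with characteristic
   function E[exp(i t X)] = exp(-|t|^p).  By symmetry the characteristic
   function is real, equal to E[cos(t X)]. *)
Definition std_sym_stable (R : realType) (p : R) (mu : probability R R) : Prop :=
  (forall A : set R, measurable A -> mu ((fun x => - x) @^-1` A) = mu A) /\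
  (forall t : R, (\int[mu]_x (cos (t * x))%:E = (expR (- (`|t| `^ p)))%:E)%E).

Definition mutually_independent d (Omega : measurableType d) (R : realType)
  (P : probability Omega R) (I : finType) (X : I -> {RV P >-> R}) : Prop :=
  forall B : I -> set R, (forall i, measurable (B i)) ->
    P [set w | forall i, B i (X i w)] = (\prod_(i : I) P (X i @^-1` B i))%E.

(* Main.v *)
Require Import Defs.
From HB Require Import structures.
From mathcomp Require Import all_boot all_order all_algebra.
From mathcomp Require Import all_classical all_reals all_analysis.
From mathcomp Require Import measurable_realfun ring lra zify.
Import Order.TTheory GRing.Theory Num.Theory.
Import numFieldNormedType.Exports.
Local Open Scope classical_set_scope.
Local Open Scope ring_scope.
Set Implicit Arguments.
Unset Strict Implicit.
Unset Printing Implicit Defensive.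

(* For a unit vector y the coordinates of Pi y are i.i.d. multiples of a p-stable
   Z. Moments of Z are only accessible through E cos(tZ) = exp(-|t|^p), so |x|^p
   truncated at 2^n is replaced by
     G_n(x) = sum_(k < n) 2^(kp) (1 - cos(x / 2^k)),
   which satisfies G_n(x) <= C |x|^p (as p < 2), |x|^p <= C (1 + G_n(x)) for
   |x| < 2^n and G_n^2 <= 6 sum_k 2^(2kp) (1 - cos(x / 2^k)). Hence E G_n(Z) is of
   order n, E G_n(Z)^2 of order 2^(np), and the same cosines give
   P(|Z| >= 2^n) = O(2^(-np)). With 2^(np) of order r ln r, Chebyshev's inequality
   shows that sum_i |Z_i|^p is of order r ln r except with probability
   O(1 / ln r).
   Since ln r >= exp(c d), this survives a union bound over a net of C^d points
   of the unit sphere of the column space of A, and an approximation argument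
   extends the two-sided bound from the net to the whole column space. The size
   of the net is bounded without volumes: M separated points of the unit ball
   yield M^T separated points in a ball of radius h^T (h-adic expansions), hence
   M^T <= (C h^T)^k for every T, and so M <= h^k. *)

(** * Dyadic sums of cosines *)

Section CosineScales.
Context (R : realType).
Implicit Types (q x : R) (k n : nat).

Lemma sum_geometric_le q n : 0 <= q < 1 -> \sum_(i < n) q ^+ i <= (1 - q)^-1.
Proof.
move=> /andP[q0 q1]; have q1' : 0 < 1 - q by rewrite subr_gt0.
rewrite -(ler_pM2l q1') divff ?gt_eqF//.
have := subrX1 q n; have := exprn_ge0 n q0; nra.
Qed.

Lemma sum_geometric_le_expr q n : 2 <= q -> \sum_(i < n) q ^+ i <= q ^+ n.
Proof.
move=> q2; elim: n => [|n IH]; first by rewrite big_ord0 expr0.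
rewrite big_ord_recr /= exprS.
have : 0 <= q ^+ n by rewrite exprn_ge0//; lra.
nra.
Qed.

Lemma dyadic_scale x : 1 <= x -> exists j, 2 ^+ j <= x < 2 ^+ j.+1.
Proof.
move=> x1; have x0 : 0 <= x by lra.
have t0 : (0 < Num.truncn x)%N by rewrite truncn_gt0.
exists (trunc_log 2 (Num.truncn x)).
have /andP[t1 t2] := truncn_itv x0.
have /andP[l1 l2] := trunc_log_bounds (isT : 1 < 2)%N t0.
apply/andP; split.
  by rewrite (le_trans _ t1)// -natrX ler_nat.
by rewrite (lt_le_trans t2)// -natrX ler_nat.
Qed.

Lemma cos_le_cos1 x : 1 <= x <= 2 -> cos x <= cos 1.
Proof.
move=> /andP[]; rewrite le_eqVlt => /predU1P[<- //|x1 x2].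
rewrite ltW// ltr_cos// in_itv /=; have := @pi_ge2 R => pi2;
  apply/andP; split; lra.
Qed.

Lemma one_sub_cos1_gt0 : 0 < 1 - cos 1 :> R.
Proof.
rewrite subr_gt0 -[X in _ < X]cos0 ltr_cos// in_itv /=;
  have := @pi_ge2 R => pi2; apply/andP; split; lra.
Qed.

(** For [|x| >= 2] the left side is at most 2. Otherwise the double-angle formula gives
    [1 - cos x = 2 sin(x / 2)^2], and [sin y <= y] for [y >= 0] by the mean value theorem. *)
Lemma one_sub_cos_le_sqr x : 1 - cos x <= x ^+ 2.
Proof.
wlog x0 : x / 0 <= x.
  move=> H; have [|x0] := leP 0 x; first exact: H.
  by rewrite -cosN -sqrrN; apply: H; lra.
have [x1|x1] := leP 2 x; first by have := cos_geN1 x; nra.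
have sx (y : R) : 0 <= y -> sin y <= y.
  rewrite le_eqVlt => /predU1P[<-|y0]; first by rewrite sin0.
  have [c _] := @MVT R sin cos 0 y y0 (fun z _ => is_derive_sin z)
    (continuous_subspaceT (@continuous_sin R)).
  by rewrite sin0 !subr0 => ->; rewrite ler_piMl ?cos_le1 ?ltW.
have s2 : 0 <= sin (x / 2).
  by apply: sin_ge0_pi; have := @pi_ge2 R; lra.
have := sx (x / 2) ltac:(lra).
have := cos_mulr2n (x / 2); rewrite -[x / 2 *+ 2]mulr_natr divfK// => ->.
have := cos2Dsin2 (x / 2); nra.
Qed.

(** The summand of G_n at scale [2 ^+ k], with [q] in place of 2^p. The estimates on it use only
    [2 <= q < 4], which is what [1 <= p < 2] provides. *)
Definition cos_scale q k x := q ^+ k * (1 - cos (x / 2 ^+ k)).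

Definition cos_scales q n x := \sum_(k < n) cos_scale q k x.

Lemma cos_scale_ge0 q k x : 2 <= q -> 0 <= cos_scale q k x.
Proof.
move=> q2; have q0 : 0 <= q by lra.
by rewrite mulr_ge0 ?exprn_ge0 ?subr_ge0 ?cos_le1.
Qed.

Lemma cos_scale_le q k x : 2 <= q -> cos_scale q k x <= 2 * q ^+ k.
Proof.
move=> q2; have q0 : 0 <= q by lra.
by rewrite /cos_scale mulrC ler_wpM2r ?exprn_ge0//; have := cos_geN1 (x / 2 ^+ k); lra.
Qed.

Lemma cos_scales_ge0 q n x : 2 <= q -> 0 <= cos_scales q n x.
Proof. by move=> q2; apply: sumr_ge0 => k _; exact: cos_scale_ge0. Qed.

Lemma cos_scales_le q n x : 2 <= q -> cos_scales q n x <= 2 * q ^+ n.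
Proof.
move=> q2.
rewrite (le_trans (y := \sum_(k < n) 2 * q ^+ k))//.
  by apply: ler_sum => k _; exact: cos_scale_le.
by rewrite -mulr_sumr ler_wpM2l// sum_geometric_le_expr.
Qed.

(** The bound [1 - cos u <= u^2] turns the terms into a geometric progression of ratio [q / 4 < 1],
    so the estimate is uniform in [n]. *)
Lemma cos_scales_tail_le q m n x : 2 <= q -> q < 4 ->
  \sum_(i < n) cos_scale q (m + i) x <= (q / 4) ^+ m * x ^+ 2 / (1 - q / 4).
Proof.
move=> q2 q4; have q0 : 0 <= q by lra.
have qX_ge0 k : 0 <= q ^+ k by rewrite exprn_ge0.
apply: (@le_trans _ _ (\sum_(i < n) (q / 4) ^+ m * x ^+ 2 * (q / 4) ^+ i)).
  apply: ler_sum => i _; rewrite /cos_scale.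
  apply: (@le_trans _ _ (q ^+ (m + i) * (x / 2 ^+ (m + i)) ^+ 2)).
    by rewrite ler_wpM2l// one_sub_cos_le_sqr.
  rewrite [leRHS]mulrAC -exprD !expr_div_n -exprM mulnC exprM.
  have -> : 2 ^+ 2 = 4 :> R by ring.
  by rewrite mulrA [leLHS]mulrAC.
rewrite -mulr_sumr ler_wpM2l//; last by apply: sum_geometric_le; lra.
by rewrite mulr_ge0 ?sqr_ge0// exprn_ge0//; lra.
Qed.

(** Adding a term t to the sum S increases the square by t (2 S + t), and both S and t are at most
    [2 * q ^+ n]. The right side is linear in cosines, so its expectation is computable. *)
Lemma cos_scales_sqr_le q n x : 2 <= q ->
  cos_scales q n x ^+ 2 <= 6 * \sum_(k < n) q ^+ k * cos_scale q k x.
Proof.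
move=> q2; elim: n => [|n IH]; first by rewrite /cos_scales !big_ord0 expr0n mulr0 lexx.
have S0 := cos_scales_ge0 n x q2; have S1 := cos_scales_le n x q2.
have t0 := cos_scale_ge0 n x q2; have t1 := cos_scale_le n x q2.
rewrite {1}/cos_scales !big_ord_recr/= -/(cos_scales q n x) mulrDr.
nra.
Qed.

(** * Comparison of the cosine sums with |x|^p *)

Section Powers.
Context (p : R).
Local Notation q := (2 `^ p).

Lemma two_powR_ge2 : 1 <= p -> 2 <= q.
Proof. by move=> p1; rewrite -[X in X <= _]powRr1// ler_powR ?ler1n. Qed.

Lemma two_powR_lt4 : p < 2 -> q < 4.
Proof.
move=> p2.
rewrite (_ : 4 = 2 `^ 2%:R); last by rewrite powR_mulrn//; ring.
rewrite -(@expRK R p) /powR pnatr_eq0 /= ltr_expR ltr_pM2r ?expRK//.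
by rewrite ln_gt0// ltr1n.
Qed.

Lemma powR_expr2 k : (2 ^+ k) `^ p = q ^+ k :> R.
Proof. by rewrite -(powR_mulrn k (ler0n R 2)) -(powR_mulrn k (powR_ge0 2 p)) powRAC. Qed.

Lemma powR_dyadic j x : 1 <= p -> p < 2 ->
  2 ^+ j <= x < 2 ^+ j.+1 -> q ^+ j <= x `^ p <= 4 * q ^+ j.
Proof.
move=> p1 p2 /andP[x1 x2]; have q4 := two_powR_lt4 p2; have p0 : 0 <= p by lra.
have j0 : 0 <= 2 ^+ j :> R by rewrite exprn_ge0.
have x0 := le_trans j0 x1.
apply/andP; split.
  by rewrite -powR_expr2 ge0_ler_powR ?nnegrE.
rewrite (@le_trans _ _ (q ^+ j.+1))//.
  by rewrite -powR_expr2 ge0_ler_powR ?nnegrE ?exprn_ge0// ltW.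
by rewrite exprS ler_wpM2r ?exprn_ge0 ?powR_ge0 ?ltW.
Qed.

(** The 8 accounts for the scales up to [|x|], the quotient for the geometric tail beyond them. *)
Definition cos_scales_ub := 8 + 4 / (1 - q / 4).

Lemma cos_scales_ub_gt0 : p < 2 -> 0 < cos_scales_ub.
Proof.
move=> p2; have q4 := two_powR_lt4 p2.
by rewrite /cos_scales_ub ltr_pwDl// divr_ge0//; lra.
Qed.

(* At scales above |x| use [1 - cos u <= u^2], which is summable because
   [q < 4]; at scales below |x| use [1 - cos u <= 2]. *)
Lemma cos_scales_le_powR n x : 1 <= p -> p < 2 ->
  cos_scales q n x <= cos_scales_ub * `|x| `^ p.
Proof.
move=> p1 p2; have q2 := two_powR_ge2 p1; have q4 := two_powR_lt4 p2.
have q0 : 0 <= q by rewrite powR_ge0.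
have q4' : 0 < (1 - q / 4)^-1 by rewrite invr_gt0; lra.
have [x1|x1] := leP 1 `|x|; last first.
  have := cos_scales_tail_le 0 n x q2 q4; rewrite expr0 mul1r => /le_trans; apply.
  have xp : x ^+ 2 <= `|x| `^ p.
    have [->|x0] := eqVneq x 0; first by rewrite expr0n/= powR_ge0.
    by rewrite -real_normK ?num_real// -powR_mulrn// ger_powR ?normr_gt0 ?x0 ?ltW.
  rewrite /cos_scales_ub.
  have := powR_ge0 `|x| p; have := sqr_ge0 x; nra.
have [j jx] := dyadic_scale x1.
have /andP[xq _] := powR_dyadic p1 p2 jx; have /andP[_ jx2] := jx.
(* The summands are nonnegative, so lengthening the sum to [j.+1 + n] terms is harmless; it can then
   be split at the scale of [|x|] without comparing [n] with [j]. *)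
have big : cos_scales q (j.+1 + n) x <= cos_scales_ub * `|x| `^ p.
  rewrite /cos_scales big_split_ord /=.
  have h1 := cos_scales_le j.+1 x q2.
  have h2 := cos_scales_tail_le j.+1 n x q2 q4.
  have qj : q ^+ j.+1 <= 4 * `|x| `^ p.
    by rewrite exprS; apply: ler_pM => //; exact: ltW.
  have h3 : (q / 4) ^+ j.+1 * x ^+ 2 <= 4 * `|x| `^ p.
    rewrite (le_trans _ qj)// expr_div_n mulrAC ler_pdivrMr ?exprn_gt0//.
    rewrite ler_wpM2l ?exprn_ge0//.
    rewrite (_ : 4 = 2 ^+ 2 :> R); last by ring.
    rewrite -exprM mulnC exprM -real_normK ?num_real//.
    by rewrite lerXn2r ?nnegrE ?exprn_ge0 ?normr_ge0 ?(ltW jx2).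
  have h4 := ler_wpM2r (ltW q4') h3.
  have -> : cos_scales_ub * `|x| `^ p = 8 * `|x| `^ p + 4 * `|x| `^ p / (1 - q / 4).
    by rewrite /cos_scales_ub; ring.
  by apply: (le_trans (lerD h1 h2)); apply: lerD => //; lra.
rewrite (le_trans _ big)// /cos_scales addnC big_split_ord /= lerDl.
by apply: sumr_ge0 => k _; exact: cos_scale_ge0.
Qed.

(** One summand suffices: at the dyadic scale j of [|x|] the argument [|x| / 2^j] lies in [1, 2],
    where [1 - cos] is at least [1 - cos 1]. The truncation [|x| < 2 ^+ n] ensures that this summand
    is present, and the added 1 covers [|x| < 1]. *)
Lemma powR_le_cos_scales n x : 1 <= p -> p < 2 -> `|x| < 2 ^+ n ->
  `|x| `^ p <= 4 / (1 - cos 1) * (1 + cos_scales q n x).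
Proof.
move=> p1 p2 xn; have q2 := two_powR_ge2 p1; have c0 := one_sub_cos1_gt0; have c1 := @cos1_gt0 R.
have G0 := cos_scales_ge0 n x q2.
have c4 : 4 <= 4 / (1 - cos 1) :> R by rewrite ler_pdivlMr//; lra.
have [x1|x1] := leP 1 `|x|; last first.
  have : `|x| `^ p <= 1 `^ p by apply: ge0_ler_powR; rewrite ?nnegrE ?normr_ge0 ?ler01 ?(ltW x1)//; lra.
  rewrite powR1; nra.
have [j jx] := dyadic_scale x1.
have /andP[_ xq] := powR_dyadic p1 p2 jx; have /andP[jx1 jx2] := jx.
have jn : (j < n)%N.
  rewrite ltnNge; apply/negP => nj.
  have : 2 ^+ n <= 2 ^+ j :> R by rewrite ler_eXn2l// ltr1n.
  by move: jx1 xn; lra.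
have j0 : 0 < 2 ^+ j :> R by rewrite exprn_gt0.
have cx : cos (x / 2 ^+ j) <= cos 1.
  rewrite -cos_norm normrM normfV (ger0_norm (ltW j0)) cos_le_cos1//.
  by rewrite ler_pdivlMr// mul1r jx1 ler_pdivrMr// -exprS ltW.
have Gj : q ^+ j * (1 - cos 1) <= cos_scales q n x.
  rewrite /cos_scales (bigD1 (Ordinal jn))//= ler_wpDr//.
    by apply: sumr_ge0 => k _; exact: cos_scale_ge0.
  by rewrite ler_wpM2l ?exprn_ge0 ?powR_ge0//; lra.
rewrite (le_trans xq)// -mulrA ler_wpM2l// mulrC ler_pdivlMr//; lra.
Qed.

End Powers.
End CosineScales.

(** * Independent stable variables *)

Section BoundedMeasurable.
Context d (T : measurableType d) (R : realType).
Implicit Types f g : T -> R.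

(** A class closed under sums and products and integrable for every probability. It contains all
    cosines, sines and indicators used below, so that linearity of [Ex] needs no other integrability
    argument. *)
Definition bounded_measurable f :=
  measurable_fun [set: T] f /\ exists C, forall x, `|f x| <= C.

Lemma bm_cst (c : R) : bounded_measurable (fun=> c).
Proof. by split; [exact: measurable_cst | exists `|c|]. Qed.

Lemma bmD f g : bounded_measurable f -> bounded_measurable g ->
  bounded_measurable (fun x => f x + g x).
Proof.
move=> [mf [C fC]] [mg [D gD]]; split; first exact: measurable_funD.
by exists (C + D) => x; rewrite (le_trans (ler_normD _ _))// lerD.
Qed.

Lemma bmN f : bounded_measurable f -> bounded_measurable (fun x => - f x).
Proof.
move=> [mf [C fC]]; split; first exact: measurable_funN.
by exists C => x; rewrite normrN.
Qed.

Lemma bmB f g : bounded_measurable f -> bounded_measurable g ->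
  bounded_measurable (fun x => f x - g x).
Proof. by move=> bf bg; apply: bmD => //; exact: bmN. Qed.

Lemma bmM f g : bounded_measurable f -> bounded_measurable g ->
  bounded_measurable (fun x => f x * g x).
Proof.
move=> [mf [C fC]] [mg [D gD]]; split; first exact: measurable_funM.
by exists (C * D) => x; rewrite normrM ler_pM.
Qed.

Lemma bm_sum (I : Type) (s : seq I) (Q : pred I) (f : I -> T -> R) :
  (forall i, bounded_measurable (f i)) ->
  bounded_measurable (fun x => \sum_(i <- s | Q i) f i x).
Proof.
move=> bf; elim: s => [|i s IH].
  by under eq_fun do rewrite big_nil; exact: bm_cst.
under eq_fun do rewrite big_cons; case: (Q i) => //; exact: bmD.
Qed.

Lemma bm_prod (I : Type) (s : seq I) (Q : pred I) (f : I -> T -> R) :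
  (forall i, bounded_measurable (f i)) ->
  bounded_measurable (fun x => \prod_(i <- s | Q i) f i x).
Proof.
move=> bf; elim: s => [|i s IH].
  by under eq_fun do rewrite big_nil; exact: bm_cst.
under eq_fun do rewrite big_cons; case: (Q i) => //; exact: bmM.
Qed.

Lemma bm_indic (A : set T) : measurable A -> bounded_measurable \1_A.
Proof.
move=> mA; split; first exact: measurable_indic.
by exists 1 => x; rewrite indicE; case: (x \in A); rewrite ?normr1 ?normr0.
Qed.

Lemma bm_cos f : measurable_fun [set: T] f ->
  bounded_measurable (fun x => cos (f x)).
Proof.
move=> mf; split; last by exists 1 => x; exact: cos_max.
apply: measurableT_comp => //.
apply: continuous_measurable_fun; exact: continuous_cos.
Qed.

Lemma bm_sin f : measurable_fun [set: T] f ->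
  bounded_measurable (fun x => sin (f x)).
Proof.
move=> mf; split; last by exists 1 => x; exact: sin_max.
apply: measurableT_comp => //.
apply: continuous_measurable_fun; exact: continuous_sin.
Qed.

Variable P : probability T R.

Definition Ex f : R := \int[P]_x f x.

Lemma bm_integrable f : bounded_measurable f ->
  P.-integrable [set: T] (EFin \o f).
Proof.
move=> [mf [C fC]]; apply: measurable_bounded_integrable => //.
  by rewrite (le_lt_trans (probability_le1 _ _))// ltry.
exists C; split; first exact: num_real.
by move=> M CM x _; exact: le_trans (fC x) (ltW CM).
Qed.

Lemma Ex_cst (c : R) : Ex (fun=> c) = c.
Proof.
rewrite /Ex Rintegral_cst// [X in fine X](_ : _ = 1%E) ?mulr1//.
exact: probability_setT.
Qed.

Lemma ExD f g : bounded_measurable f -> bounded_measurable g ->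
  Ex (fun x => f x + g x) = Ex f + Ex g.
Proof. by move=> bf bg; rewrite /Ex RintegralD//; exact: bm_integrable. Qed.

Lemma ExB f g : bounded_measurable f -> bounded_measurable g ->
  Ex (fun x => f x - g x) = Ex f - Ex g.
Proof. by move=> bf bg; rewrite /Ex RintegralB//; exact: bm_integrable. Qed.

Lemma ExZ (c : R) f : bounded_measurable f -> Ex (fun x => c * f x) = c * Ex f.
Proof. by move=> bf; rewrite /Ex RintegralZl//; exact: bm_integrable. Qed.

Lemma le_Ex f g : bounded_measurable f -> bounded_measurable g ->
  (forall x, f x <= g x) -> Ex f <= Ex g.
Proof. by move=> bf bg fg; apply: le_Rintegral => //; exact: bm_integrable. Qed.

Lemma Ex_sum (I : Type) (s : seq I) (Q : pred I) (f : I -> T -> R) :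
  (forall i, bounded_measurable (f i)) ->
  Ex (fun x => \sum_(i <- s | Q i) f i x) = \sum_(i <- s | Q i) Ex (f i).
Proof.
move=> bf; elim: s => [|i s IH].
  by under eq_fun do rewrite big_nil; rewrite big_nil Ex_cst.
under eq_fun do rewrite big_cons; rewrite big_cons.
by case: (Q i) => //; rewrite ExD ?IH//; exact: bm_sum.
Qed.

Lemma Ex_indic (A : set T) : measurable A -> Ex \1_A = fine (P A).
Proof. by move=> mA; rewrite /Ex /Rintegral integral_indic// setIT. Qed.

Lemma Ex_norm_le f (C : R) : bounded_measurable f -> (forall x, `|f x| <= C) ->
  `|Ex f| <= C.
Proof.
move=> bf fC; rewrite ler_norml -[X in X <= _](Ex_cst (- C)).
rewrite -[X in _ && (_ <= X)](Ex_cst C).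
by apply/andP; split; apply: le_Ex => //; try exact: bm_cst; move=> x;
  have := fC x; rewrite ler_norml => /andP[].
Qed.

End BoundedMeasurable.

Lemma bounded_measurable_comp d d' (T : measurableType d) (U : measurableType d')
    (R : realType) (X : U -> T) (f : T -> R) :
  measurable_fun [set: U] X -> bounded_measurable f ->
  bounded_measurable (fun x => f (X x)).
Proof.
move=> mX [mf [C fC]]; split; first exact: measurableT_comp.
by exists C.
Qed.

(** * Product formulas and stability of linear combinations *)

Section Independence.
Context d (T : measurableType d) (R : realType) (P : probability T R).

(** The identity is linear in [g], hence holds for step functions, and a bounded [g] is a uniform
    limit of step functions built on its own level sets. *)
Lemma Ex_mul_comp_indic (Y X : T -> R) (g : R -> R) :
  bounded_measurable Y -> measurable_fun [set: T] X -> bounded_measurable g ->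
  (forall B, measurable B ->
    Ex P (fun w => \1_B (X w) * Y w) = Ex P (fun w => \1_B (X w)) * Ex P Y) ->
  Ex P (fun w => g (X w) * Y w) = Ex P (fun w => g (X w)) * Ex P Y.
Proof.
move=> bY mX bg indep.
have [mg [C0 gC0]] := bg; have [_ [D YD]] := bY.
have [C gC] : exists C : nat, forall x, `|g x| <= C%:R.
  exists (Num.truncn C0).+1 => x; rewrite (le_trans (gC0 x))// ltW//.
  by rewrite truncnS_gt.
have gC' x : 0 <= g x + C%:R.
  by have := gC x; rewrite ler_norml => /andP[]; lra.
have D0 : 0 <= D by rewrite (le_trans _ (YD point)).
have bgX : bounded_measurable (fun w => g (X w)).
  exact: (bounded_measurable_comp mX bg).
apply/eqP; rewrite -subr_eq0 -normr_le0; apply/ler_addgt0Pr => e e0.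
(* Rounding [g] down to a multiple of [1 / n] changes each side by at most [D / n]; this [n] makes
   the two errors together less than [e]. *)
pose n := (Num.truncn (2 * D / e)).+1.
have nD : 2 * D / e < n%:R by rewrite /n truncnS_gt.
have n0 : 0 < n%:R :> R by rewrite ltr0n.
(* Since [g + C] lies in [0, 2 C], the rounded value of [n * (g + C)] ranges over 0, ..., 2 C n. *)
pose m := (2 * C * n).+1.
pose k x := Num.truncn (n%:R * (g x + C%:R)).
pose B (i : 'I_m) : set R := [set x | k x = i].
have kI x : (k x)%:R <= n%:R * (g x + C%:R) < (k x).+1%:R.
  by rewrite truncn_itv// mulr_ge0// ltW.
have mB i : measurable (B i).
  rewrite [X in measurable X](_ : _ =
    (fun x => n%:R * (g x + C%:R)) @^-1` `[(i : nat)%:R, (i : nat).+1%:R[%classic).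
    rewrite -[X in measurable X]setTI.
    have mgg : measurable_fun [set: R] (fun x => n%:R * (g x + C%:R)).
      by apply: measurable_funM => //; exact: measurable_funD.
    by apply: mgg => //; exact: measurable_itv.
  apply/seteqP; split => x; rewrite /B /= in_itv /=.
    by move=> <-; exact: kI.
  by move=> h; exact: truncn_def.
have mk x : (k x < m)%N.
  rewrite /m ltnS -(ler_nat R) (le_trans (andP (kI x)).1)//.
  rewrite mulrC !natrM ler_wpM2r ?ler0n//.
  by have := gC x; rewrite ler_norml => /andP[]; lra.
pose h x : R := \sum_(i < m) ((i%:R / n%:R - C%:R) * \1_(B i) x).
have hE x : h x = (k x)%:R / n%:R - C%:R.
  rewrite /h (bigD1 (Ordinal (mk x)))//= indicE mem_set// mulr1 big1 ?addr0//.
  move=> i /eqP ik; rewrite indicE memNset ?mulr0// => Bi.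
  by apply: ik; apply/val_inj; rewrite /= -Bi.
have gh x : `|g x - h x| <= n%:R^-1.
  rewrite hE; have /andP[k1 k2] := kI x.
  have -> : g x - ((k x)%:R / n%:R - C%:R) =
      (n%:R * (g x + C%:R) - (k x)%:R) * n%:R^-1.
    by field; rewrite gt_eqF.
  rewrite normrM (ger0_norm (x := n%:R^-1)) ?invr_ge0 ?ler0n//.
  rewrite ler_piMl ?invr_ge0 ?ler0n// ger0_norm ?subr_ge0//.
  by move: k2; rewrite -natr1; lra.
have bI i : bounded_measurable (fun w => \1_(B i) (X w) : R).
  exact: (bounded_measurable_comp mX (bm_indic R (mB i))).
have bhX : bounded_measurable (fun w => h (X w)).
  by apply: bm_sum => i; apply: bmM => //; exact: bm_cst.
have hindep : Ex P (fun w => h (X w) * Y w) = Ex P (fun w => h (X w)) * Ex P Y.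
  have -> : (fun w => h (X w) * Y w) = (fun w => \sum_(i < m)
      ((i%:R / n%:R - C%:R) * (\1_(B i) (X w) * Y w))).
    by apply/funext => w; rewrite mulr_suml; apply: eq_bigr => i _; rewrite mulrA.
  rewrite !Ex_sum; first last.
  - by move=> i; apply: bmM; [exact: bm_cst|exact: bmM].
  - by move=> i; apply: bmM; [exact: bm_cst|].
  rewrite mulr_suml; apply: eq_bigr => i _.
  by rewrite !ExZ ?indep ?mulrA//; exact: bmM.
have -> : Ex P (fun w => g (X w) * Y w) - Ex P (fun w => g (X w)) * Ex P Y =
    Ex P (fun w => (g (X w) - h (X w)) * Y w) -
    Ex P (fun w => g (X w) - h (X w)) * Ex P Y.
  rewrite ExB// mulrBl -hindep.
  under [X in _ = Ex P X - _]eq_fun do rewrite mulrBl.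
  by rewrite (ExB P (bmM bgX bY) (bmM bhX bY)); ring.
have bgh := bmB bgX bhX.
rewrite add0r (le_trans (ler_normB _ _))//.
have n10 : 0 <= n%:R^-1 :> R by rewrite invr_ge0 ler0n.
have e1 : `|Ex P (fun w => (g (X w) - h (X w)) * Y w)| <= n%:R^-1 * D.
  by apply: Ex_norm_le => [|w]; [exact: bmM|rewrite normrM ler_pM].
have e2 : `|Ex P (fun w => g (X w) - h (X w)) * Ex P Y| <= n%:R^-1 * D.
  by rewrite normrM ler_pM//; exact: Ex_norm_le.
rewrite (le_trans (lerD e1 e2))//.
move: nD; rewrite ltr_pdivrMr// => nD.
rewrite -(ler_pM2l n0) mulrDr !mulrA divff ?gt_eqF//; lra.
Qed.

Variables (I : finType) (X : I -> {RV P >-> R}).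
Hypothesis indX : mutually_independent X.

Let bgX (f : R -> R) i : bounded_measurable f ->
  bounded_measurable (fun w => f (X i w)).
Proof. by move=> bf; exact: (bounded_measurable_comp (measurable_funPT (X i)) bf). Qed.

(** Indicators are replaced by bounded functions one index at a time: [s] lists the indices where
    [g] is arbitrary. For empty [s] the formula is the definition of mutual independence;
    [Ex_mul_comp_indic] frees one more index. *)
Lemma Ex_prod_independent (g : I -> R -> R) :
  (forall i, bounded_measurable (g i)) ->
  Ex P (fun w => \prod_i g i (X i w)) = \prod_i Ex P (fun w => g i (X i w)).
Proof.
suff H (s : seq I) : forall g : I -> R -> R,
    (forall i, bounded_measurable (g i)) ->
    (forall i, i \notin s -> exists2 B, measurable B & g i = \1_B) ->
  Ex P (fun w => \prod_i g i (X i w)) = \prod_i Ex P (fun w => g i (X i w)).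
  by move=> bg; apply: (H (enum I)) => // i; rewrite mem_enum.
elim: s => {g} [g _ gB|a s IH g bg gB].
  have /choice[B BP] : forall i, exists B, measurable B /\ g i = \1_B.
    by move=> i; have [B mB gE] := gB i isT; exists B.
  have mB i : measurable (B i) by have [] := BP i.
  have -> : (fun w => \prod_i g i (X i w)) =
      \1_[set w | forall i, B i (X i w)] :> (T -> R).
    apply/funext => w; rewrite indicE; have [BX|] := pselect (forall i, B i (X i w)).
      rewrite mem_set// big1// => i _.
      by rewrite (BP i).2 indicE mem_set.
    move=> /existsNP[i nB]; rewrite memNset; last by move=> /(_ i).
    by rewrite (bigD1 i)//= (BP i).2 indicE memNset// mul0r.
  have mXB i : measurable (X i @^-1` B i) by exact: measurable_funPTI.
  rewrite Ex_indic; last first.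
    rewrite [X in measurable X](_ : _ = \bigcap_(i in [set: I]) (X i @^-1` B i)).
      by apply: fin_bigcap_measurable => //; exact: finite_finset.
    by apply/seteqP; split => w h i; [move=> _; exact: h | exact: (h i Logic.I)].
  rewrite indX//.
  have -> : (\prod_(i : I) P (X i @^-1` B i))%E =
      (\prod_(i : I) fine (P (X i @^-1` B i)))%:E.
    rewrite -prodEFin; apply: eq_bigr => i _.
    by rewrite fineK// fin_num_measure.
  apply: eq_bigr => i _; rewrite -Ex_indic//; congr (Ex P _).
  by apply/funext => w; rewrite (BP i).2.
pose g' (f : R -> R) i := if i == a then f else g i.
pose Y w := \prod_(i | i != a) g i (X i w).
have bY : bounded_measurable Y by apply: bm_prod => i; exact: bgX.
have g'E f w : \prod_i g' f i (X i w) = f (X a w) * Y w.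
  rewrite (bigD1 a)//= /g' eqxx; congr (_ * _).
  by apply: eq_bigr => i /negPf ->.
have IHB B : measurable B -> Ex P (fun w => \1_B (X a w) * Y w) =
    Ex P (fun w => \1_B (X a w)) * \prod_(i | i != a) Ex P (fun w => g i (X i w)).
  move=> mB; under eq_fun do rewrite -g'E.
  rewrite IH.
  - rewrite (bigD1 a)//= /g' eqxx; congr (_ * _).
    by apply: eq_bigr => i /negPf ->.
  - by move=> i; rewrite /g'; case: eqP => // _; exact: bm_indic.
  - move=> i is_; rewrite /g'; case: eqP => [_|ia]; first by exists B.
    by apply: gB; rewrite inE negb_or is_ andbT; exact/eqP.
(* Taking the whole line for [B] in [IHB] removes the factor at [a]. *)
have EY : Ex P Y = \prod_(i | i != a) Ex P (fun w => g i (X i w)).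
  have := IHB setT measurableT; rewrite indicT.
  under eq_fun do rewrite mul1r.
  by rewrite Ex_cst mul1r.
have -> : (fun w => \prod_i g i (X i w)) = (fun w => g a (X a w) * Y w).
  by apply/funext => w; rewrite (bigD1 a).
rewrite [RHS](bigD1 a)//= -EY; apply: Ex_mul_comp_indic => //.
by move=> B mB; rewrite IHB// EY.
Qed.

Variable p : R.
Hypothesis stX : forall i, std_sym_stable p (distribution P (X i)).

Lemma Ex_cos_stable i (t : R) : Ex P (fun w => cos (t * X i w)) = expR (- (`|t| `^ p)).
Proof.
have mt : measurable_fun [set: R] (fun x => t * x) by exact: measurable_funM.
have [_ /(_ t)] := stX i.
rewrite integral_distribution => [||]; first by rewrite /Ex /Rintegral /comp /= => ->.
  by apply/measurable_EFinP; have [] := bm_cos mt.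
apply: bm_integrable; exact: (bgX i (bm_cos mt)).
Qed.

(** By symmetry [X i] and [- X i] have the same law, and sine is odd, so the mean equals its
    opposite. *)
Lemma Ex_sin_stable i (t : R) : Ex P (fun w => sin (t * X i w)) = 0.
Proof.
have mt : measurable_fun [set: R] (fun x => t * x) by exact: measurable_funM.
have bs := bm_sin mt.
have [symX _] := stX i.
have ExE (Y : {RV P >-> R}) : Ex P (fun w => sin (t * Y w)) =
    Ex (distribution P Y) (fun x => sin (t * x)).
  rewrite /Ex /Rintegral integral_distribution//.
    by apply/measurable_EFinP; case: bs.
  by apply: bm_integrable; exact: (bounded_measurable_comp (measurable_funPT Y) bs).
pose Y : {RV P >-> R} := - X i.
have : Ex P (fun w => sin (t * X i w)) = Ex P (fun w => sin (t * Y w)).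
  rewrite !ExE /Ex /Rintegral; congr fine.
  by apply: eq_measure_integral => A mA _; rewrite -[LHS]symX.
have -> : (fun w => sin (t * Y w)) = (fun w => -1 * sin (t * X i w)).
  by apply/funext => w; rewrite /Y /= mulrN sinN mulN1r.
rewrite ExZ; last exact: (bgX i bs).
lra.
Qed.

(** This is multiplicativity of characteristic functions, in real form: cosine and sine stand for
    the real and imaginary parts, and the imaginary parts vanish. *)
Lemma Ex_cos_sum (u : I -> R) :
  Ex P (fun w => cos (\sum_i u i * X i w)) = expR (- \sum_i `|u i| `^ p).
Proof.
have mS (s : seq I) : measurable_fun [set: T] (fun w => \sum_(i <- s) u i * X i w).
  by apply: measurable_sum => i; exact: measurable_funM.
(* The addition formulas mix cosine and sine, so both are treated in one induction. The arbitrary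
   factors [g i] at the indices outside [s] absorb the cosine or sine of the term split off at
   [a]. *)
suff H (s : seq I) : uniq s -> forall g : I -> R -> R,
    (forall i, bounded_measurable (g i)) ->
    Ex P (fun w => cos (\sum_(i <- s) u i * X i w) *
                   \prod_(i | i \notin s) g i (X i w)) =
      expR (- \sum_(i <- s) `|u i| `^ p) *
        \prod_(i | i \notin s) Ex P (fun w => g i (X i w)) /\
    Ex P (fun w => sin (\sum_(i <- s) u i * X i w) *
                   \prod_(i | i \notin s) g i (X i w)) = 0.
  have [+ _] := H _ (index_enum_uniq I) (fun=> cst 1) (fun=> bm_cst R 1).
  have e0 F : \prod_(i | i \notin index_enum I) F i = 1 :> R.
    by rewrite big_pred0// => i; rewrite mem_index_enum.
  under eq_fun do rewrite e0 mulr1.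
  by rewrite e0 mulr1.
elim: s => [_ g bg|a s IH /= /andP[as_ us] g bg].
  rewrite big_nil oppr0 expR0 mul1r; split.
    under eq_fun do rewrite big_nil cos0 mul1r.
    exact: Ex_prod_independent.
  by under eq_fun do rewrite big_nil sin0 mul0r; rewrite Ex_cst.
have mu1 : measurable_fun [set: R] (fun x => u a * x) by exact: measurable_funM.
pose g' (f : R -> R) i := if i == a then f else g i.
have bg' f : bounded_measurable f -> forall i, bounded_measurable (g' f i).
  by move=> bf i; rewrite /g'; case: eqP.
have prodE (F : I -> R) :
    \prod_(i | i \notin s) F i = F a * \prod_(i | i \notin a :: s) F i.
  rewrite (bigD1 a)//=; congr (_ * _); apply: eq_bigl => i.
  by rewrite inE negb_or andbC.
have g'E f w : \prod_(i | i \notin s) g' f i (X i w) =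
    f (X a w) * \prod_(i | i \notin a :: s) g i (X i w).
  rewrite prodE /g' eqxx; congr (_ * _); apply: eq_bigr => i.
  by rewrite inE negb_or => /andP[/negPf ->].
have bgc f h : bounded_measurable h -> bounded_measurable f ->
    bounded_measurable (fun w => h w *
       \prod_(i | i \notin s) g' f i (X i w)).
  by move=> bh bf; apply: bmM => //; apply: bm_prod => i; exact/bgX/bg'.
have [Cc Cs] := IH us _ (bg' _ (bm_cos mu1)).
have [Sc Ss] := IH us _ (bg' _ (bm_sin mu1)).
have EE f : \prod_(i | i \notin s) Ex P (fun w => g' f i (X i w)) =
   Ex P (fun w => f (X a w)) * \prod_(i | i \notin a :: s) Ex P (fun w => g i (X i w)).
  rewrite prodE /g' eqxx; congr (_ * _); apply: eq_bigr => i.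
  by rewrite inE negb_or => /andP[/negPf ->].
split.
  transitivity (Ex P (fun w => cos (\sum_(i <- s) u i * X i w) *
      \prod_(i | i \notin s) g' (fun x => cos (u a * x)) i (X i w) -
    sin (\sum_(i <- s) u i * X i w) *
      \prod_(i | i \notin s) g' (fun x => sin (u a * x)) i (X i w))).
    congr (Ex P _); apply/funext => w; rewrite !g'E big_cons cosD; ring.
  rewrite ExB; last 2 first.
  - exact: bgc (bm_cos (mS s)) (bm_cos mu1).
  - exact: bgc (bm_sin (mS s)) (bm_sin mu1).
  rewrite Cc Ss subr0 EE Ex_cos_stable big_cons opprD expRD; ring.
transitivity (Ex P (fun w => sin (\sum_(i <- s) u i * X i w) *
      \prod_(i | i \notin s) g' (fun x => cos (u a * x)) i (X i w) +
    cos (\sum_(i <- s) u i * X i w) *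
      \prod_(i | i \notin s) g' (fun x => sin (u a * x)) i (X i w))).
  congr (Ex P _); apply/funext => w; rewrite !g'E big_cons sinD; ring.
rewrite ExD; last 2 first.
- exact: bgc (bm_sin (mS s)) (bm_cos mu1).
- exact: bgc (bm_cos (mS s)) (bm_sin mu1).
by rewrite Cs Sc EE Ex_sin_stable; ring.
Qed.

End Independence.

(** * Concentration of power sums *)

Section Concentration.
Context d (T : measurableType d) (R : realType) (P : probability T R).
Context (p : R) (r : nat) (Z : 'I_r -> T -> R).
Local Notation q := (2 `^ p : R).
Hypothesis mZ : forall i, measurable_fun [set: T] (Z i).
Hypothesis cosZ : forall i t,
  Ex P (fun w => cos (t * Z i w)) = expR (- (`|t| `^ p)).
Hypothesis cosZZ : forall i j s t, i != j ->
  Ex P (fun w => cos (s * Z i w) * cos (t * Z j w)) =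
  expR (- (`|s| `^ p)) * expR (- (`|t| `^ p)).

Definition scale_mean k : R := q ^+ k * (1 - expR (- (q ^+ k)^-1)).

Definition scales_mean n : R := \sum_(k < n) scale_mean k.

(** With s = q^(-k) in (0, 1], s / 2 <= s / (1 + s) <= 1 - exp(-s) <= s. Every scale thus
    contributes a mean of order 1, which is the source of the logarithmic factor in the
    normalization. *)
Lemma scale_mean_bounds k : 1 <= p -> 2^-1 <= scale_mean k <= 1.
Proof.
move=> p1; have q2 := two_powR_ge2 p1.
have qk1 : 1 <= q ^+ k by rewrite exprn_ege1//; lra.
rewrite /scale_mean; set a := q ^+ k in qk1 *.
have a0 : 0 < a by lra.
set s := a^-1; have as1 : a * s = 1 by rewrite divff// gt_eqF.
have s0 : 0 < s by rewrite invr_gt0.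
have s1 : s <= 1 by rewrite invf_le1.
have e1 := expR_ge1Dx (- s).
have e2 := expR_ge1Dx s.
have e3 : expR (- s) * expR s = 1 by rewrite -expRD addNr expR0.
have e4 := expR_gt0 (- s).
have e5 : 1 - expR (- s) >= s / 2 by nra.
apply/andP; split; nra.
Qed.

Lemma scales_mean_bounds n : 1 <= p -> n%:R / 2 <= scales_mean n <= n%:R.
Proof.
move=> p1; apply/andP; split.
  rewrite mulr_natl -{1}(card_ord n) -sumr_const ler_sum// => k _.
  by have /andP[] := scale_mean_bounds k p1.
rewrite -[leRHS]mulr1 mulr_natl -{2}(card_ord n) -sumr_const ler_sum// => k _.
by have /andP[] := scale_mean_bounds k p1.
Qed.

Lemma bm_cosZ i (t : R) : bounded_measurable (fun w => cos (t * Z i w)).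
Proof. by apply: bm_cos; exact: measurable_funM. Qed.

Let scaleE k i w : cos_scale q k (Z i w) =
  q ^+ k * (1 - cos ((2 ^+ k)^-1 * Z i w)).
Proof. by rewrite /cos_scale mulrC [_ / _]mulrC mulrC. Qed.

Lemma bm_cos_scale k i : bounded_measurable (fun w => cos_scale q k (Z i w)).
Proof.
under eq_fun do rewrite scaleE.
by apply: bmM; [exact: bm_cst | apply: bmB; [exact: bm_cst | exact: bm_cosZ]].
Qed.

Let powR_inv k : `|(2 ^+ k)^-1| `^ p = (q ^+ k)^-1 :> R.
Proof.
have k0 : 0 <= 2 ^+ k :> R by rewrite exprn_ge0.
have qk0 : 0 <= q ^+ k by rewrite exprn_ge0// powR_ge0.
rewrite ger0_norm ?invr_ge0// -(powR_inv1 k0) powRAC powR_expr2.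
by rewrite powR_inv1.
Qed.

Lemma Ex_cos_scale k i : Ex P (fun w => cos_scale q k (Z i w)) = scale_mean k.
Proof.
under eq_fun do rewrite scaleE.
have b1 := bm_cst T (1 : R); have bc := bm_cosZ i (2 ^+ k)^-1.
by rewrite ExZ ?ExB ?Ex_cst ?cosZ ?powR_inv//; exact: bmB.
Qed.

Lemma Ex_cos_scaleM k l i j : i != j ->
  Ex P (fun w => cos_scale q k (Z i w) * cos_scale q l (Z j w)) =
  scale_mean k * scale_mean l.
Proof.
move=> ij; have b1 := bm_cst T (1 : R).
set a := (2 ^+ k)^-1 : R; set b := (2 ^+ l)^-1 : R.
have ba := bm_cosZ i a; have bb := bm_cosZ j b.
transitivity (Ex P (fun w => q ^+ k * q ^+ l * ((1 - cos (a * Z i w)) -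
    (cos (b * Z j w) - cos (a * Z i w) * cos (b * Z j w))))).
  by congr (Ex P _); apply/funext => w; rewrite !scaleE; ring.
rewrite ExZ; last by apply: bmB; [exact: bmB | apply: bmB => //; exact: bmM].
rewrite ExB; [|exact: bmB|by apply: bmB => //; exact: bmM].
rewrite (ExB P b1 ba) (ExB P bb (bmM ba bb)).
by rewrite Ex_cst cosZZ// !cosZ !powR_inv /scale_mean; ring.
Qed.

Lemma bm_cos_scales n i : bounded_measurable (fun w => cos_scales q n (Z i w)).
Proof. by apply: bm_sum => k; exact: bm_cos_scale. Qed.

Lemma Ex_cos_scales n i :
  Ex P (fun w => cos_scales q n (Z i w)) = scales_mean n.
Proof.
rewrite Ex_sum => [|k]; last exact: bm_cos_scale.
by apply: eq_bigr => k _; exact: Ex_cos_scale.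
Qed.

Lemma Ex_cos_scalesM n i j : i != j ->
  Ex P (fun w => cos_scales q n (Z i w) * cos_scales q n (Z j w)) =
  scales_mean n ^+ 2.
Proof.
move=> ij; rewrite expr2 /scales_mean mulr_suml.
under eq_fun do rewrite mulr_suml.
rewrite Ex_sum => [|k]; last first.
  by apply: bmM; [exact: bm_cos_scale | exact: bm_cos_scales].
apply: eq_bigr => k _; rewrite mulr_sumr.
under eq_fun do rewrite mulr_sumr.
rewrite Ex_sum => [|l]; last by apply: bmM; exact: bm_cos_scale.
by apply: eq_bigr => l _; exact: Ex_cos_scaleM.
Qed.

Lemma Ex_cos_scales_sqr n i : 1 <= p ->
  Ex P (fun w => cos_scales q n (Z i w) ^+ 2) <= 6 * q ^+ n.
Proof.
move=> p1; have q2 := two_powR_ge2 p1.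
have bG := bm_cos_scales n i.
have bt k : bounded_measurable (fun w => q ^+ k * cos_scale q k (Z i w)).
  by apply: bmM; [exact: bm_cst | exact: bm_cos_scale].
have bs : bounded_measurable (fun w => \sum_(k < n) q ^+ k * cos_scale q k (Z i w)).
  exact: bm_sum.
apply: (@le_trans _ _ (Ex P (fun w =>
    6 * \sum_(k < n) q ^+ k * cos_scale q k (Z i w)))).
  apply: le_Ex => [||w]; [exact: bmM | | exact: cos_scales_sqr_le].
  by apply: bmM => //; exact: bm_cst.
rewrite ExZ// ler_wpM2l// Ex_sum//.
apply: le_trans (sum_geometric_le_expr n q2); apply: ler_sum => k _.
rewrite ExZ; last exact: bm_cos_scale.
rewrite Ex_cos_scale ler_piMr ?exprn_ge0 ?powR_ge0//.
by have /andP[] := scale_mean_bounds k p1.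
Qed.

(** Off-diagonal covariances vanish by [cosZZ], so a product formula for pairs is enough; each
    diagonal variance is at most the second moment. *)
Lemma variance_cos_scales n : 1 <= p ->
  Ex P (fun w => (\sum_i cos_scales q n (Z i w) - r%:R * scales_mean n) ^+ 2)
    <= r%:R * (6 * q ^+ n).
Proof.
move=> p1; set m := scales_mean n.
pose D i w := cos_scales q n (Z i w) - m.
have bG i := bm_cos_scales n i.
have bm := bm_cst T m.
have bD i : bounded_measurable (D i) by exact: bmB.
have ExD0 i : Ex P (D i) = 0 by rewrite ExB// Ex_cst Ex_cos_scales subrr.
apply: (@le_trans _ _ (Ex P (fun w => \sum_i \sum_j D i w * D j w))).
  rewrite le_eqVlt; apply/orP; left; apply/eqP; congr (Ex P _); apply/funext => w; rewrite expr2.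
  have -> : \sum_i cos_scales q n (Z i w) - r%:R * m = \sum_i D i w.
    by rewrite big_split/= sumrN sumr_const card_ord mulr_natl.
  by rewrite mulr_suml; apply: eq_bigr => i _; rewrite mulr_sumr.
have bDD i j : bounded_measurable (fun w => D i w * D j w) by exact: bmM.
rewrite Ex_sum; last by move=> i; exact: bm_sum.
have -> : r%:R * (6 * q ^+ n) = \sum_(i < r) 6 * q ^+ n.
  by rewrite sumr_const card_ord mulr_natl.
apply: ler_sum => i _.
rewrite Ex_sum// (bigD1 i)//= big1 ?addr0 => [|j ji].
  apply: le_trans (Ex_cos_scales_sqr n i p1).
  apply: (@le_trans _ _ (Ex P (fun w => cos_scales q n (Z i w) ^+ 2 - 2 * m * D i w - m ^+ 2))).
    by rewrite le_eqVlt; apply/orP; left; apply/eqP; congr (Ex P _); apply/funext => w; rewrite /D; ring.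
  have b2 : bounded_measurable (fun w => cos_scales q n (Z i w) ^+ 2) by exact: bmM.
  have b3 : bounded_measurable (fun w => 2 * m * D i w).
    by apply: bmM => //; exact: bm_cst.
  rewrite ExB; [|exact: bmB|exact: bm_cst].
  rewrite ExB// ExZ// ExD0 Ex_cst mulr0 subr0.
  by rewrite lerBlDr lerDl sqr_ge0.
have -> : (fun w => D i w * D j w) = (fun w =>
    cos_scales q n (Z i w) * cos_scales q n (Z j w) - (m * D i w + m * D j w + m ^+ 2)).
  by apply/funext => w; rewrite /D; ring.
have bGG : bounded_measurable (fun w => cos_scales q n (Z i w) * cos_scales q n (Z j w)).
  exact: bmM.
have bmD' k : bounded_measurable (fun w => m * D k w) by exact: bmM.
rewrite ExB//; last by apply: bmD; [exact: bmD | exact: bm_cst].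
rewrite ExD; [|exact: bmD|exact: bm_cst].
rewrite ExD// !ExZ// !ExD0 Ex_cst Ex_cos_scalesM 1?eq_sym//.
by rewrite -/m !mulr0 !add0r subrr.
Qed.

Lemma measurable_dyadic i k :
  measurable [set w | 2 ^+ k <= `|Z i w|] /\
  measurable [set w | 2 ^+ k <= `|Z i w| < 2 ^+ k.+1].
Proof.
have mn : measurable_fun [set: T] (fun w => `|Z i w|) by exact: measurableT_comp.
split.
  rewrite [X in measurable X](_ : _ = (fun w => `|Z i w|) @^-1` `[2 ^+ k, +oo[%classic).
    by rewrite -[X in measurable X]setTI; apply: mn => //; exact: measurable_itv.
  by apply/seteqP; split => w /=; rewrite in_itv/= andbT.
rewrite [X in measurable X](_ : _ = (fun w => `|Z i w|) @^-1` `[2 ^+ k, 2 ^+ k.+1[%classic).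
  by rewrite -[X in measurable X]setTI; apply: mn => //; exact: measurable_itv.
by apply/seteqP; split => w /=; rewrite in_itv.
Qed.

(** On the shell, [1 - cos (Z i w / 2 ^+ k)] is at least [1 - cos 1], so the indicator is dominated
    by a multiple of [cos_scale], whose mean is at most 1. *)
Lemma Ex_dyadic_le i k : 1 <= p ->
  Ex P \1_[set w | 2 ^+ k <= `|Z i w| < 2 ^+ k.+1] <=
  (q ^+ k)^-1 / (1 - cos 1).
Proof.
move=> p1; have [_ mA] := measurable_dyadic i k.
have c0 := @one_sub_cos1_gt0 R; have q2 := two_powR_ge2 p1.
have qk0 : 0 < q ^+ k by rewrite exprn_gt0// powR_gt0.
set c := (q ^+ k)^-1 / (1 - cos 1).
have c'0 : 0 <= c by rewrite divr_ge0 ?invr_ge0 ?ltW.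
apply: (@le_trans _ _ (Ex P (fun w => c * cos_scale q k (Z i w)))).
  apply: le_Ex => [||w]; first exact: bm_indic.
    by apply: bmM; [exact: bm_cst | exact: bm_cos_scale].
  rewrite indicE; case: (boolP (w \in _)) => [|_]; last by rewrite mulr_ge0 ?cos_scale_ge0.
  rewrite inE /= => /andP[w1 w2].
  have k0 : 0 < 2 ^+ k :> R by rewrite exprn_gt0.
  have cx : cos (Z i w / 2 ^+ k) <= cos 1.
    rewrite -cos_norm normrM normfV (ger0_norm (ltW k0)) cos_le_cos1//.
    by rewrite ler_pdivlMr// mul1r w1 ler_pdivrMr// -exprS ltW.
  rewrite /c /cos_scale mulrAC mulrA mulVf ?gt_eqF// mul1r ler_pdivlMr//; lra.
rewrite ExZ; last exact: bm_cos_scale.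
rewrite Ex_cos_scale ler_piMr//.
by have /andP[] := scale_mean_bounds k p1.
Qed.

(** The tail event is covered by the shells of index [n + k], whose bounds decrease geometrically
    with ratio at most 1/2; hence the factor 2. *)
Lemma stable_tail_le i n : 1 <= p ->
  Ex P \1_[set w | 2 ^+ n <= `|Z i w|] <= 2 * (q ^+ n)^-1 / (1 - cos 1).
Proof.
move=> p1; have q2 := two_powR_ge2 p1; have c0 := @one_sub_cos1_gt0 R.
pose A k := [set w | 2 ^+ (n + k) <= `|Z i w| < 2 ^+ (n + k).+1].
have mA k : measurable (A k) := (measurable_dyadic i (n + k)).2.
have mB := (measurable_dyadic i n).1.
have BA : [set w | 2 ^+ n <= `|Z i w|] `<=` \bigcup_k A k.
  move=> w /= nw.
  have [j jx] : exists j, 2 ^+ j <= `|Z i w| < 2 ^+ j.+1.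
    by apply: dyadic_scale; rewrite (le_trans _ nw)// exprn_ege1// ler1n.
  have nj : (n <= j)%N.
    rewrite -ltnS ltnNge; apply/negP => jn; move: jx => /andP[_].
    by rewrite ltNge (le_trans _ nw)// ler_eXn2l// ltr1n.
  by exists (j - n)%N => //; rewrite /A /= subnKC.
rewrite Ex_indic// -lee_fin fineK ?fin_num_measure//.
apply: (le_trans (measure_sigma_subadditive _ _ _ BA)) => //.
have q0 : 0 < q by rewrite powR_gt0.
apply: lime_le; first exact: is_cvg_nneseries.
apply: nearW => N.
have -> : (\sum_(0 <= k < N) P (A k))%E = (\sum_(0 <= k < N) Ex P \1_(A k))%:E.
  rewrite -sumEFin; apply: eq_bigr => k _.
  by rewrite Ex_indic// fineK// fin_num_measure.
rewrite lee_fin big_mkord.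
apply: (@le_trans _ _ (\sum_(k < N) (q ^+ n)^-1 / (1 - cos 1) * q^-1 ^+ k)).
  apply: ler_sum => k _; apply: (le_trans (Ex_dyadic_le i (n + k) p1)).
  by rewrite exprD invfM exprVn mulrAC.
have nn : 0 <= (q ^+ n)^-1 / (1 - cos 1).
  by rewrite divr_ge0 ?invr_ge0 ?exprn_ge0// ltW.
rewrite -mulr_sumr -[leRHS]mulrA mulrC ler_wpM2r//.
have qi : q^-1 <= 2^-1 by rewrite lef_pV2 ?posrE.
apply: (@le_trans _ _ (1 - q^-1)^-1).
  by apply: sum_geometric_le; rewrite invr_ge0 ltW//=; lra.
by rewrite invf_ple ?posrE//; lra.
Qed.

End Concentration.

(** * Truncation level and exceptional event *)

Lemma exists_pow_scale (R : realType) (q x : R) : 2 <= q -> q <= 4 -> 1 <= x ->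
  exists n, x <= q ^+ n <= 4 * x.
Proof.
move=> q2 q4 x1; have x0 : 0 <= x by lra.
have exn : exists n, x <= q ^+ n.
  exists (Num.truncn x).+1; rewrite ltW// (lt_le_trans (truncnS_gt x))//.
  apply: (@le_trans _ _ (2 ^+ (Num.truncn x).+1)).
    by rewrite -natrX ler_nat ltnW// ltn_expl.
  by rewrite lerXn2r ?nnegrE//; lra.
exists (ex_minn exn); case: ex_minnP => -[|n] xn nmin.
  by rewrite xn expr0; lra.
have qn : q ^+ n <= x.
  by rewrite leNgt; apply/negP => /ltW xq; have := nmin _ xq; rewrite ltnn.
have qn0 : 0 <= q ^+ n by rewrite exprn_ge0//; lra.
by rewrite xn /= exprS; nra.
Qed.

(** From exp(1/2) <= 2 <= q <= 4 <= exp(2) one gets exp(L) <= exp(2 n) and exp(n / 2) <= 4 L exp(L)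
    <= exp(2 + 2 L). With [L = ln r], the number of scales is of order ln r. *)
Lemma scale_linear_ln (R : realType) (q L : R) n : 2 <= q -> q <= 4 -> 1 <= L ->
  expR L * L <= q ^+ n <= 4 * (expR L * L) -> L / 2 <= n%:R <= 8 * L.
Proof.
move=> q2 q4 L1 /andP[nL1 nL2]; have q0 : 0 <= q by lra.
have eL := expR_gt0 L.
have e1 : 2 <= expR 1 :> R by have := expR_ge1Dx (1 : R); lra.
have e2 : 4 <= expR 2 :> R.
  by rewrite (_ : 2 = 1 + 1 :> R)// expRD; nra.
apply/andP; split.
  rewrite ler_pdivrMr// -ler_expR expRM_natl.
  apply: (@le_trans _ _ (expR L * L)); first by nra.
  by apply: (le_trans nL1); rewrite lerXn2r ?nnegrE ?expR_ge0//; lra.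
have eh : expR 2^-1 <= 2 :> R.
  have := expR_ge1Dx (- 2^-1 : R); have := expR_gt0 (2^-1 : R).
  have : expR (- 2^-1) * expR 2^-1 = 1 :> R by rewrite -expRD addNr expR0.
  nra.
suff : n%:R * 2^-1 <= 2 + (L + L) by lra.
rewrite -ler_expR expRM_natl !expRD.
apply: (@le_trans _ _ (q ^+ n)).
  by rewrite lerXn2r ?nnegrE ?expR_ge0//; lra.
apply: (le_trans nL2).
have LL : L <= expR L by have := expR_ge1Dx L; lra.
apply: ler_pM; rewrite ?mulr_ge0 ?(ltW eL)//; [lra|nra|].
by rewrite ler_wpM2l// ltW.
Qed.

Section PowerSum.
Context (R : realType) (p : R).
Local Notation q := (2 `^ p : R).

(** The quotient bounds the union of the tail events. The 1536 = 96 * 16 is Chebyshev's share: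
    variance at most 24 r^2 L, deviation r m / 2, and m >= L / 4. *)
Definition fail_const : R := 2 / (1 - cos 1) + 1536.
(** Off the exceptional event the sum V of the G_n(Z_i) lies between r L / 8 and 12 r L. In
    [sum_hi], 13 = 12 + 1 also pays for the added 1 in [powR_le_cos_scales]. *)
Definition sum_lo : R := (8 * cos_scales_ub p)^-1.
Definition sum_hi : R := 13 * (4 / (1 - cos 1)).

Context d (T : measurableType d) (P : probability T R).
Context (r : nat) (Z : 'I_r -> T -> R).

(** The level [n] with q^n of order r L balances two failures: some |Z_i| reaches 2^n with
    probability of order r q^(-n), and V deviates from its mean by half with probability of order
    q^n / (r n^2). Both are of order 1 / L. *)
Lemma stable_power_sum (L : R) : 1 <= p -> p < 2 -> 1 <= L -> expR L = r%:R ->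
  (forall i, measurable_fun [set: T] (Z i)) ->
  (forall i t, Ex P (fun w => cos (t * Z i w)) = expR (- (`|t| `^ p))) ->
  (forall i j s t, i != j ->
    Ex P (fun w => cos (s * Z i w) * cos (t * Z j w)) =
    expR (- (`|s| `^ p)) * expR (- (`|t| `^ p))) ->
  exists Bad : set T, [/\ measurable Bad, Ex P \1_Bad <= fail_const / L &
    forall w, ~ Bad w ->
      sum_lo * (r%:R * L) <= \sum_i `|Z i w| `^ p <= sum_hi * (r%:R * L)].
Proof.
move=> p1 p2 L1 rL mZ cosZ cosZZ.
have q2 := two_powR_ge2 p1; have q4 := two_powR_lt4 p2.
have c0 := @one_sub_cos1_gt0 R.
have [n nrL] := @exists_pow_scale R q (r%:R * L) q2 (ltW q4) ltac:(have := expR_ge1Dx L; nra).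
have /andP[n1 n2] : L / 2 <= n%:R <= 8 * L.
  by apply: (scale_linear_ln q2 (ltW q4) L1); rewrite rL.
have r1 : 1 <= r%:R :> R by have := expR_ge1Dx L; lra.
have /andP[m1 m2] := @scales_mean_bounds R p n p1.
set m := scales_mean p n in m1 m2 *.
have rm0 : 0 < r%:R * m by nra.
pose V w := \sum_i cos_scales q n (Z i w).
have bV : bounded_measurable V by apply: bm_sum => i; exact: bm_cos_scales.
have bD : bounded_measurable (fun w => (V w - r%:R * m) ^+ 2).
  by apply: bmM; apply: bmB => //; exact: bm_cst.
pose BV := [set w | (r%:R * m / 2) ^+ 2 <= (V w - r%:R * m) ^+ 2].
have mBV : measurable BV.
  rewrite [X in measurable X](_ : _ =
    (fun w => (V w - r%:R * m) ^+ 2) @^-1` `[(r%:R * m / 2) ^+ 2, +oo[%classic).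
    have [mD _] := bD.
    by rewrite -[X in measurable X]setTI; apply: mD => //; exact: measurable_itv.
  by apply/seteqP; split => w /=; rewrite in_itv/= andbT.
pose A i := [set w | 2 ^+ n <= `|Z i w|].
have mA i : measurable (A i) by have [] := measurable_dyadic mZ i n.
exists (BV `|` \bigcup_(i in [set: 'I_r]) A i).
have mBad : measurable (BV `|` \bigcup_(i in [set: 'I_r]) A i).
  by apply: measurableU => //; apply: fin_bigcup_measurable.
have /andP[nr1 nr2] := nrL.
have qn0 : 0 < q ^+ n by rewrite exprn_gt0// powR_gt0.
split=> // [|w nBad].
- have bA i := bm_indic R (mA i).
  have bsA : bounded_measurable (fun w => \sum_(i < r) \1_(A i) w : R) by exact: bm_sum.
  have bD' : bounded_measurable (fun w => ((r%:R * m / 2) ^+ 2)^-1 * (V w - r%:R * m) ^+ 2).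
    by apply: bmM => //; exact: bm_cst.
  (* Chebyshev's inequality and the union bound over the tails follow from one pointwise domination
     of the indicator. *)
  apply: (@le_trans _ _ (Ex P (fun w => ((r%:R * m / 2) ^+ 2)^-1 * (V w - r%:R * m) ^+ 2
      + \sum_(i < r) \1_(A i) w))).
    apply: le_Ex => [||w]; [exact: bm_indic|exact: bmD|].
    have s0 : 0 <= \sum_(i < r) \1_(A i) w :> R by apply: sumr_ge0.
    have h0 : 0 < (r%:R * m / 2) ^+ 2 by rewrite exprn_gt0//; lra.
    have t0 : 0 <= ((r%:R * m / 2) ^+ 2)^-1 * (V w - r%:R * m) ^+ 2.
      by rewrite mulr_ge0 ?sqr_ge0// invr_ge0 ltW.
    rewrite indicE; case: (boolP (w \in _)) => [|_]; last by rewrite addr_ge0.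
    rewrite inE => -[wB|[i _ Ai]].
      by rewrite ler_wpDr// mulrC ler_pdivlMr// mul1r.
    rewrite ler_wpDl// (bigD1 i)//= indicE mem_set// lerDl.
    by apply: sumr_ge0.
  rewrite ExD// ExZ// Ex_sum//.
  have e1 := variance_cos_scales mZ cosZ cosZZ n p1.
  have e2 : \sum_(i < r) Ex P \1_(A i) <= r%:R * (2 * (q ^+ n)^-1 / (1 - cos 1)).
    have -> : r%:R * (2 * (q ^+ n)^-1 / (1 - cos 1)) =
        \sum_(i < r) (2 * (q ^+ n)^-1 / (1 - cos 1)).
      by rewrite sumr_const card_ord mulr_natl.
    by apply: ler_sum => i _; exact: (stable_tail_le mZ cosZ).
  rewrite [leRHS]mulrDl addrC; apply: lerD.
    apply: (le_trans e2).
    rewrite ler_pdivlMr; last by lra.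
    have -> : r%:R * (2 * (q ^+ n)^-1 / (1 - cos 1)) * L =
        2 / (1 - cos 1) * (r%:R * L / q ^+ n) by ring.
    by rewrite ler_piMr ?divr_ge0 ?(ltW c0)// ler_pdivrMr// mul1r.
  rewrite mulrC ler_pdivrMr ?exprn_gt0//; last by lra.
  apply: (le_trans e1).
  rewrite mulrAC ler_pdivlMr; last by lra.
  have h1 : (L / 2) ^+ 2 <= n%:R ^+ 2 by rewrite lerXn2r ?nnegrE//; lra.
  have h2 : n%:R ^+ 2 <= (2 * m) ^+ 2 by rewrite lerXn2r ?nnegrE//; nra.
  have h3 : r%:R * (6 * q ^+ n) * L <= r%:R * (6 * (4 * (r%:R * L))) * L.
    by rewrite ler_wpM2r ?ler_wpM2l//; lra.
  apply: (le_trans h3).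
  have -> : r%:R * (6 * (4 * (r%:R * L))) * L = r%:R ^+ 2 * (96 * (L / 2) ^+ 2) by field.
  have -> : 1536 * (r%:R * m / 2) ^+ 2 = r%:R ^+ 2 * (96 * (2 * m) ^+ 2) by field.
  by rewrite !ler_wpM2l ?sqr_ge0// (le_trans h1).
have ZA i : `|Z i w| < 2 ^+ n.
  by rewrite ltNge; apply/negP => Ai; apply: nBad; right; exists i.
have VB : (V w - r%:R * m) ^+ 2 < (r%:R * m / 2) ^+ 2.
  by rewrite ltNge; apply/negP => h; apply: nBad; left.
have V1 : r%:R * m / 2 <= V w.
  by rewrite leNgt; apply/negP => h; nra.
have V2 : V w <= 3 / 2 * (r%:R * m).
  by rewrite leNgt; apply/negP => h; nra.
have u0 := cos_scales_ub_gt0 p2.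
have rmL : r%:R * L / 4 <= r%:R * m by nra.
have rmU : r%:R * m <= 8 * (r%:R * L) by nra.
apply/andP; split.
  rewrite /sum_lo mulrC ler_pdivrMr; last by lra.
  apply: (@le_trans _ _ (8 * V w)); first by lra.
  have : V w <= cos_scales_ub p * \sum_i `|Z i w| `^ p.
    by rewrite mulr_sumr; apply: ler_sum => i _; exact: cos_scales_le_powR.
  lra.
apply: (@le_trans _ _ (4 / (1 - cos 1) * (r%:R + V w))).
  have -> : r%:R + V w = \sum_i (1 + cos_scales q n (Z i w)).
    by rewrite big_split/= sumr_const card_ord.
  by rewrite mulr_sumr; apply: ler_sum => i _; exact: powR_le_cos_scales.
rewrite /sum_hi [13 * _]mulrC -[leRHS]mulrA ler_wpM2l ?divr_ge0 ?(ltW c0)//.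
have : r%:R <= r%:R * L by rewrite ler_peMr.
lra.
Qed.

End PowerSum.

(** * The l_p norm and nets *)

Section LpNorm.
Context (R : realType) (p : R).

Lemma lpnorm_ge0 m (v : 'cV[R]_m) : 0 <= lpnorm p v.
Proof. exact: powR_ge0. Qed.

Lemma sum_powR_ge0 m (v : 'cV[R]_m) : 0 <= \sum_i `|v i 0| `^ p.
Proof. by apply: sumr_ge0 => i _; exact: powR_ge0. Qed.

Lemma lpnorm_powR m (v : 'cV[R]_m) : 1 <= p ->
  lpnorm p v `^ p = \sum_i `|v i 0| `^ p.
Proof.
move=> p1; have p0 : p != 0 by apply: lt0r_neq0; lra.
by rewrite /lpnorm -powRrM mulVf// powRr1// sum_powR_ge0.
Qed.

Lemma lpnormZ m (c : R) (v : 'cV[R]_m) : 1 <= p ->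
  lpnorm p (c *: v) = `|c| * lpnorm p v.
Proof.
move=> p1; have p0 : p != 0 by apply: lt0r_neq0; lra.
rewrite /lpnorm.
under eq_bigr do rewrite mxE normrM powRM//.
rewrite -mulr_sumr powRM ?powR_ge0 ?sum_powR_ge0//.
by rewrite -powRrM mulfV// powRr1.
Qed.

Lemma lpnorm0_eq0 m (v : 'cV[R]_m) : lpnorm p v = 0 -> v = 0.
Proof.
move=> /powR_eq0_eq0 /eqP; rewrite psumr_eq0 => [/allP v0|i _]; last exact: powR_ge0.
apply/colP => i; rewrite mxE; apply/normr0_eq0/powR_eq0_eq0/eqP.
by apply: v0; rewrite mem_index_enum.
Qed.

Lemma normr_le_lpnorm m (v : 'cV[R]_m) i : 1 <= p -> `|v i 0| <= lpnorm p v.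
Proof.
move=> p1; have p0 : p != 0 by apply: lt0r_neq0; lra.
rewrite -[leLHS]powRr1// -(mulfV p0) powRrM ge0_ler_powR ?nnegrE ?powR_ge0//.
- by rewrite invr_ge0; lra.
- exact: sum_powR_ge0.
- by rewrite (bigD1 i)//= lerDl; apply: sumr_ge0 => j _; exact: powR_ge0.
Qed.

Lemma powR_convex (t x y : R) : 1 <= p -> 0 <= t <= 1 -> 0 <= x -> 0 <= y ->
  (t * x + (1 - t) * y) `^ p <= t * x `^ p + (1 - t) * y `^ p.
Proof.
move=> p1 /andP[t0 t1] x0 y0.
have := convex_powR p1 (Itv01 t0 t1) (x := x) (y := y).
by rewrite !convRE /=; apply; rewrite inE /= in_itv /= andbT.
Qed.

(** The pointwise form of Minkowski's inequality: [(x + y) / (a + b)] is the convex combination of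
    [x / a] and [y / b] with weights [a / (a + b)] and [b / (a + b)]. *)
Lemma powR_add_le (a b x y z : R) : 1 <= p -> 0 < a -> 0 < b -> 0 <= x ->
  0 <= y -> 0 <= z -> z <= x + y ->
  z `^ p <= (a + b) `^ p * (a / (a + b) * (x `^ p / a `^ p) +
    (1 - a / (a + b)) * (y `^ p / b `^ p)).
Proof.
move=> p1 a0 b0 x0 y0 z0 zxy.
have ab0 : 0 < a + b by rewrite addr_gt0.
have t0 : 0 <= a / (a + b) by rewrite divr_ge0 ?(ltW a0) ?(ltW ab0).
have t1 : a / (a + b) <= 1 by rewrite ler_pdivrMr// mul1r lerDl ltW.
have e (u c : R) : 0 <= u -> 0 < c -> u `^ p / c `^ p = (u / c) `^ p.
  move=> u0 c0; have ci : 0 <= c^-1 by rewrite invr_ge0 ltW.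
  rewrite (powRM _ u0 ci) -(powR_inv1 (ltW c0)) powRAC powR_inv1//.
  exact: powR_ge0.
have xa : 0 <= x / a by rewrite divr_ge0// ltW.
have yb : 0 <= y / b by rewrite divr_ge0// ltW.
have cvx : (a / (a + b) * (x / a) + (1 - a / (a + b)) * (y / b)) `^ p <=
    a / (a + b) * (x / a) `^ p + (1 - a / (a + b)) * (y / b) `^ p.
  by apply: powR_convex => //; rewrite t0.
rewrite !e//; apply: le_trans (ler_wpM2l (powR_ge0 _ _) cvx).
have w0 : 0 <= a / (a + b) * (x / a) + (1 - a / (a + b)) * (y / b).
  by rewrite addr_ge0// mulr_ge0// subr_ge0.
rewrite -(powRM _ (ltW ab0) w0).
have -> : (a + b) * (a / (a + b) * (x / a) + (1 - a / (a + b)) * (y / b)) = x + y.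
  by field; rewrite !gt_eqF.
by apply: ge0_ler_powR; rewrite ?nnegrE ?addr_ge0//; lra.
Qed.

(** [powR_add_le] is summed over the coordinates with [a] and [b] the two norms, so that each
    normalized sum is 1. Zero norms are treated apart because of the divisions. *)
Lemma lpnormD m (u v : 'cV[R]_m) : 1 <= p ->
  lpnorm p (u + v) <= lpnorm p u + lpnorm p v.
Proof.
move=> p1; have p0 : 0 <= p by lra.
have pn0 : p != 0 by apply: lt0r_neq0; lra.
move aE : (lpnorm p u) => a; move bE : (lpnorm p v) => b.
have a0 : 0 <= a by rewrite -aE lpnorm_ge0.
have b0 : 0 <= b by rewrite -bE lpnorm_ge0.
have [a_eq0|a_neq0] := eqVneq a 0.
  by rewrite a_eq0 (lpnorm0_eq0 (etrans aE a_eq0)) [X in lpnorm _ X]add0r bE add0r.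
have [b_eq0|b_neq0] := eqVneq b 0.
  by rewrite b_eq0 (lpnorm0_eq0 (etrans bE b_eq0)) [X in lpnorm _ X]addr0 aE addr0.
have {a_neq0}a0 : 0 < a by rewrite lt0r a_neq0.
have {b_neq0}b0 : 0 < b by rewrite lt0r b_neq0.
have ab0 : 0 < a + b by rewrite addr_gt0.
have abn0 : a + b != 0 by rewrite gt_eqF.
have an0 : a != 0 by rewrite gt_eqF.
have bn0 : b != 0 by rewrite gt_eqF.
have abE : a + b = ((a + b) `^ p) `^ p^-1.
  by rewrite -powRrM (mulfV pn0) (powRr1 (ltW ab0)).
rewrite abE /lpnorm; apply: ge0_ler_powR; rewrite ?nnegrE ?powR_ge0 ?sum_powR_ge0//.
  by rewrite invr_ge0.
pose t := a / (a + b).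
have t01 : 0 <= t <= 1.
  rewrite /t divr_ge0 ?(ltW a0) ?(ltW ab0)//=.
  by rewrite ler_pdivrMr// mul1r lerDl (ltW b0).
apply: (@le_trans _ _ (\sum_i (a + b) `^ p *
    (t * (`|u i 0| `^ p / a `^ p) + (1 - t) * (`|v i 0| `^ p / b `^ p)))).
  apply: ler_sum => i _; rewrite mxE.
  exact: powR_add_le (ler_normD _ _).
rewrite -mulr_sumr big_split/= -!mulr_sumr -!mulr_suml -!lpnorm_powR// aE bE.
rewrite !divff ?gt_eqF ?powR_gt0//.
by rewrite (_ : t * 1 + _ = 1) ?mulr1//; ring.
Qed.

End LpNorm.

(** * Packings and nets for a norm on R^k *)

Section Nets.
Context (R : realType) (k : nat).
Local Notation V := 'cV[R]_k.

(** Used both for [N], which [coordN] makes a norm, and for the norm of the image under the random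
    matrix, whose definiteness is not known beforehand. *)
Definition is_seminorm (N : V -> R) :=
  (forall x y, N (x + y) <= N x + N y) /\ (forall (c : R) x, N (c *: x) = `|c| * N x).

Lemma seminorm0 (N : V -> R) : is_seminorm N -> N 0 = 0.
Proof. by move=> [_ NZ]; rewrite -(scale0r 0) NZ normr0 mul0r. Qed.

Lemma seminormN (N : V -> R) x : is_seminorm N -> N (- x) = N x.
Proof. by move=> [_ NZ]; rewrite -scaleN1r NZ normrN1 mul1r. Qed.

Lemma seminorm_ge0 (N : V -> R) x : is_seminorm N -> 0 <= N x.
Proof.
move=> hN; have [ND _] := hN.
by have := ND x (- x); rewrite subrr seminorm0// seminormN//; lra.
Qed.

Lemma seminorm_sub_le (N : V -> R) x y : is_seminorm N -> N x <= N y + N (x - y).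
Proof. by move=> [ND _]; rewrite -{1}(subrK y x) addrC ND. Qed.

Lemma seminorm_le_coord (N : V -> R) (x : V) (e : R) : is_seminorm N ->
  (forall i, `|x i 0| <= e) -> N x <= e * \sum_i N (delta_mx i 0).
Proof.
move=> hN xe; have [ND NZ] := hN.
have sumN (s : seq 'I_k) (F : 'I_k -> V) :
    N (\sum_(i <- s) F i) <= \sum_(i <- s) N (F i).
  elim: s => [|i s IH]; first by rewrite !big_nil seminorm0.
  by rewrite !big_cons (le_trans (ND _ _))// lerD2l.
rewrite {1}(matrix_sum_delta x); under eq_bigr do rewrite big_ord1.
rewrite (le_trans (sumN _ _))// mulr_sumr; apply: ler_sum => i _.
by rewrite NZ ler_wpM2r// seminorm_ge0.
Qed.

Variables (N : V -> R) (c1 : R).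
Hypothesis hN : is_seminorm N.
Hypothesis coordN : forall (x : V) i, `|x i 0| <= c1 * N x.

Definition separated (J : finType) (f : J -> V) (delta : R) :=
  forall i j, i != j -> delta <= N (f i - f j).

(** Pigeonhole: rounding coordinates to a grid of mesh [tau] is injective on a separated family. The
    crude constant [c] depends on [N]; what matters is growth of order [rho ^ k]. *)
Lemma card_separated (delta : R) : 0 < delta ->
  exists c : nat, forall (J : finType) (f : J -> V) (rho : nat),
    (0 < rho)%N -> (forall j, N (f j) <= rho%:R) -> separated f delta ->
    (#|J| <= (c * rho) ^ k)%N.
Proof.
(* The added 1 makes [c2] positive and the final comparison strict: points of one cell are within
   [delta - tau]. *)
move=> d0; pose c2 := \sum_i N (delta_mx i 0) + 1.
have c2_gt0 : 0 < c2.
  by rewrite ltr_wpDl// sumr_ge0// => i _; exact: seminorm_ge0.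
pose tau := delta / c2; have tau0 : 0 < tau by rewrite divr_gt0.
pose c1' := `|c1|.
have coordN' (x : V) i : `|x i 0| <= c1' * N x.
  rewrite (le_trans (coordN x i))// ler_wpM2r ?ler_norm//; exact: seminorm_ge0.
pose c0 := (Num.truncn (2 * c1' / tau)).+1.
exists c0.+1 => J f rho rho0 fr fs.
pose g j i := Num.truncn ((f j i 0 + c1' * rho%:R) / tau).
have coordf j i : `|f j i 0| <= c1' * rho%:R.
  by rewrite (le_trans (coordN' _ _))// ler_wpM2l// normr_ge0.
have gge j i : 0 <= (f j i 0 + c1' * rho%:R) / tau.
  by rewrite divr_ge0 ?(ltW tau0)//; have := coordf j i; rewrite ler_norml => /andP[]; lra.
have gI j i : (g j i)%:R <= (f j i 0 + c1' * rho%:R) / tau < (g j i).+1%:R.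
  exact: truncn_itv.
have gS j i : (g j i < c0.+1 * rho)%N.
  rewrite -(ltr_nat R); have /andP[gl _] := gI j i; apply: (le_lt_trans gl).
  apply: (@le_lt_trans _ _ (2 * c1' / tau * rho%:R)).
    rewrite mulrAC ler_wpM2r ?invr_ge0 ?(ltW tau0)//.
    by have := coordf j i; rewrite ler_norml => /andP[]; lra.
  rewrite natrM ltr_pM2r ?ltr0n// (lt_trans (truncnS_gt _))//.
  by rewrite ltr_nat.
pose G j : {ffun 'I_k -> 'I_(c0.+1 * rho)} := [ffun i => Ordinal (gS j i)].
suff Ginj : injective G.
  by have := leq_card G Ginj; rewrite card_ffun !card_ord.
move=> j j' Gjj'; apply/eqP; apply: contraT => jj'.
have gE i : g j i = g j' i.
  by have := congr1 (fun h : {ffun 'I_k -> 'I_(c0.+1 * rho)} => val (h i)) Gjj'; rewrite !ffunE.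
have close i : `|(f j - f j') i 0| <= tau.
  have /andP[l1 u1] := gI j i; have /andP[l2 u2] := gI j' i.
  move: l2 u2; rewrite -gE => l2 u2.
  have -> : (f j - f j') i 0 = ((f j i 0 + c1' * rho%:R) / tau -
      (f j' i 0 + c1' * rho%:R) / tau) * tau.
    by rewrite !mxE; field; rewrite gt_eqF.
  rewrite normrM (gtr0_norm tau0) ler_piMl ?(ltW tau0)// ler_norml.
  by move: u1 u2; rewrite -natr1; lra.
have := fs _ _ jj'; have := seminorm_le_coord hN close.
have -> : tau * \sum_i N (delta_mx i 0) = delta - tau.
  by rewrite /tau /c2; field; rewrite gt_eqF.
lra.
Qed.

(* Powers of a packing: [(s, i) |-> h * F s + f i] keeps the separation while
   multiplying radii by about [h]. *)
Lemma separated_power (h M T : nat) (f : 'I_M -> V) (delta : R) :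
  (2 <= h)%N -> 2 <= delta * (h%:R - 1) -> 0 < delta ->
  (forall i, N (f i) <= 1) -> separated f delta ->
  exists (J : finType) (F : J -> V),
    [/\ #|J| = (M ^ T)%N, forall j, N (F j) <= h%:R ^+ T - 1 & separated F delta].
Proof.
move=> h2 dh d0 f1 fs; have [ND NZ] := hN.
have h2' : 2 <= h%:R :> R by rewrite ler_nat.
elim: T => [|T [J [F [cJ F1 Fs]]]].
  exists unit, (fun=> 0); split => [|j|[] []]; rewrite ?card_unit//.
  by rewrite seminorm0// expr0 subrr.
exists (J * 'I_M)%type, (fun s => h%:R *: F s.1 + f s.2); split.
- by rewrite card_prod cJ card_ord expnSr.
- move=> [j i] /=; rewrite (le_trans (ND _ _))// NZ ger0_norm//.
  have := F1 j; have := f1 i; rewrite exprS; nra.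
- move=> [j i] [j' i'] /= ne.
  have -> : h%:R *: F j + f i - (h%:R *: F j' + f i') =
      h%:R *: (F j - F j') + (f i - f i').
    by rewrite scalerBr opprD addrACA.
  have [jj'|jj'] := eqVneq j j'.
    rewrite jj' subrr scaler0 add0r; apply: fs.
    by apply: contra ne => /eqP ->; rewrite jj'.
  (* Distinct leading parts are at distance at least [h * delta], and the last digits take away at
     most 2; the hypothesis [2 <= delta * (h - 1)] leaves [delta]. *)
  have fii : N (f i - f i') <= 2.
    rewrite (le_trans (ND _ _))// seminormN//.
    by have := f1 i; have := f1 i'; lra.
  have h1 := seminorm_sub_le (h%:R *: (F j - F j')) (- (f i - f i')) hN.
  have h3 := Fs _ _ jj'.
  move: h1; rewrite opprK NZ ger0_norm// seminormN//; nra.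
Qed.

(** If [M > H], the hypothesis contradicts Bernoulli's inequality (1 + 1/H)^T >= 1 + T/H, stated
    without denominators, at [T = D * H]. *)
Lemma expn_le_growth (M H D : nat) : (0 < H)%N ->
  (forall T, M ^ T <= D * H ^ T)%N -> (M <= H)%N.
Proof.
move=> H0 MT; rewrite leqNgt; apply/negP => HM.
have bern T : (H ^ T * (H + T) <= H.+1 ^ T * H)%N.
  elim: T => [|T IH]; first by rewrite !expn0 addn0.
  rewrite !expnS; move: IH; move: (H ^ T)%N (H.+1 ^ T)%N => u v IH.
  have : (H.+1 * (u * (H + T)) <= H.+1 * (v * H))%N by rewrite leq_mul2l IH.
  nia.
have := bern (D * H)%N; have := MT (D * H)%N.
have : (H.+1 ^ (D * H) <= M ^ (D * H))%N by case: (D * H)%N => [|e]; rewrite ?expn0// leq_exp2r.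
have : (0 < H ^ (D * H))%N by rewrite expn_gt0 H0.
move: (H ^ _)%N (H.+1 ^ _)%N (M ^ _)%N => u v w; nia.
Qed.

(** The crude bound on the T-th power of the packing reads M^T <= c^k (h^k)^T. As T is arbitrary,
    the factor c^k and with it the dependence on [N] disappear. *)
Lemma card_separated_ball (h M : nat) (f : 'I_M -> V) (delta : R) :
  (2 <= h)%N -> 2 <= delta * (h%:R - 1) -> 0 < delta ->
  (forall i, N (f i) <= 1) -> separated f delta -> (M <= h ^ k)%N.
Proof.
move=> h2 dh d0 f1 fs; have [c cP] := card_separated d0.
have h0 : (0 < h)%N by exact: leq_trans h2.
apply: (@expn_le_growth _ _ (c ^ k)%N); first by rewrite expn_gt0 h0.
move=> T; have [J [F [<- F1 Fs]]] := separated_power T h2 dh d0 f1 fs.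
have -> : (c ^ k * (h ^ k) ^ T = (c * h ^ T) ^ k)%N.
  by rewrite expnMn -!expnM (mulnC k).
apply: (cP J F) => //.
  by rewrite expn_gt0 h0.
by move=> j; rewrite (le_trans (F1 j))// natrX; lra.
Qed.

(** A separated family on the unit sphere of maximal cardinality is a net, since a point far from
    all its members could be added to it. *)
Lemma exists_net (h : nat) (delta : R) :
  (2 <= h)%N -> 2 <= delta * (h%:R - 1) -> 0 < delta ->
  exists (M : nat) (f : 'I_M -> V), [/\ (M <= h ^ k)%N, forall i, N (f i) = 1
    & forall x, N x = 1 -> exists i, N (x - f i) <= delta].
Proof.
move=> h2 dh d0; have [ND NZ] := hN.
pose Q M := `[< exists f : 'I_M -> V, (forall i, N (f i) = 1) /\ separated f delta >].
have Q0 : exists M, Q M.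
  exists 0%N; apply/asboolP; exists (fun=> 0); split; first by case.
  by case.
have Qub M : Q M -> (M <= h ^ k)%N.
  move=> /asboolP[f [f1 fs]]; apply: (card_separated_ball h2 dh d0 _ fs).
  by move=> i; rewrite f1.
case: (ex_maxnP Q0 Qub) => M /[dup] /Qub Mh /asboolP[f [f1 fs]] Mmax.
exists M, f; split=> // x x1; apply: contrapT => /forallNP nx.
suff /Mmax : Q M.+1 by rewrite ltnn.
have xf i : delta <= N (x - f i) by rewrite ltW// ltNge; apply/negP/nx.
apply/asboolP; exists (fun i => if unlift ord0 i is Some j then f j else x); split.
  by move=> i; case: unliftP => [j|].
move=> i i'; case: unliftP => [j ->|->]; case: unliftP => [j' ->|->].
- by rewrite (inj_eq lift_inj); exact: fs.
- by move=> _; rewrite -seminormN// opprB.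
- by move=> _.
- by rewrite eqxx.
Qed.

(** Upper bound: a bound B on W / N improves to b + B / 2, and iteration converges to the fixed
    point 2 b. Lower bound: moving to the nearest net point costs at most 2 b delta <= a / 2. *)
Lemma net_extension (M : nat) (f : 'I_M -> V) (W : V -> R) (delta a b : R) :
  is_seminorm W -> (forall i, N (f i) = 1) ->
  (forall x, N x = 1 -> exists i, N (x - f i) <= delta) ->
  0 <= a -> 0 <= b -> delta <= 2^-1 -> delta * (4 * b) <= a ->
  (forall i, a <= W (f i) <= b) ->
  forall x, a / 2 * N x <= W x <= 2 * b * N x.
Proof.
move=> hW f1 net a0 b0 d2 dab Wf; have [ND NZ] := hN; have [WD WZ] := hW.
have [K0 K0P] : exists K0, forall x, W x <= K0 * N x.
  exists (c1 * \sum_i W (delta_mx i 0)) => x.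
  rewrite mulrAC; exact: (seminorm_le_coord hW (coordN x)).
(* Homogeneous relations need only be checked on the unit sphere; where [N x = 0], the a priori
   bound [K0P] forces [W x = 0]. *)
have sphere (Q : R -> R -> Prop) : (forall x, N x = 1 -> Q (W x) 1) ->
    (forall c u v, 0 < c -> Q u v -> Q (c * u) (c * v)) -> Q 0 0 ->
    forall x, Q (W x) (N x).
  move=> Q1 QZ Q0 x; have N0 := seminorm_ge0 x hN.
  have [Nx0|Nx0] := eqVneq (N x) 0.
    have W0 : W x = 0.
      by apply/eqP; rewrite eq_le seminorm_ge0// andbT (le_trans (K0P x))// Nx0 mulr0.
    by rewrite Nx0 W0.
  have Nx : 0 < N x by rewrite lt0r Nx0.
  have i0 : 0 <= (N x)^-1 by rewrite invr_ge0 ltW.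
  have := QZ (N x) (W ((N x)^-1 *: x)) 1 Nx; rewrite WZ ger0_norm// mulrA divff// mul1r mulr1.
  by apply; have := Q1 ((N x)^-1 *: x); rewrite WZ NZ ger0_norm// mulVf//; apply.
have upper1 (B : R) : 0 <= B -> (forall x, W x <= B * N x) ->
    forall x, W x <= (b + B / 2) * N x.
  move=> B0 WB; apply: (sphere (fun u v => u <= (b + B / 2) * v)) => [x x1|c u v c0|]; last by rewrite mulr0.
    have [i xi] := net x x1.
    have := seminorm_sub_le x (f i) hW; have := WB (x - f i).
    have /andP[_] := Wf i; nra.
  by move=> uv; rewrite mulrCA ler_pM2l.
have upperT T : forall x, W x <= (2 * b + `|K0| / 2 ^+ T) * N x.
  elim: T => [|T IH] x.
    rewrite expr0 divr1 (le_trans (K0P x))// ler_wpM2r ?seminorm_ge0//.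
    by have := ler_norm K0; lra.
  have B0 : 0 <= 2 * b + `|K0| / 2 ^+ T.
    by rewrite addr_ge0 ?mulr_ge0// divr_ge0// exprn_ge0.
  have := upper1 _ B0 IH x.
  have -> : b + (2 * b + `|K0| / 2 ^+ T) / 2 = 2 * b + `|K0| / 2 ^+ T.+1.
    by rewrite exprS; field; rewrite expf_neq0.
  by [].
have upper x : W x <= 2 * b * N x.
  apply/ler_addgt0Pr => e e0.
  have N0 := seminorm_ge0 x hN.
  pose T := (Num.truncn (`|K0| * N x / e)).+1.
  apply: (le_trans (upperT T x)); rewrite mulrDl lerD2l mulrAC.
  rewrite ler_pdivrMr ?exprn_gt0// [leRHS]mulrC -ler_pdivrMr//.
  have T2 : T%:R <= 2 ^+ T :> R by rewrite -natrX ler_nat ltnW// ltn_expl.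
  exact: le_trans (ltW (truncnS_gt _)) T2.
move=> x; rewrite upper andbT; move: x.
apply: (sphere (fun u v => a / 2 * v <= u)) => [x x1|c u v c0 uv|]; last by rewrite mulr0.
  have [i xi] := net x x1.
  have := seminorm_sub_le (f i) x hW; have := upper (f i - x).
  have xi' : N (f i - x) <= delta by rewrite -(seminormN _ hN) opprB.
  have := ler_wpM2l b0 xi'; have /andP[fa _] := Wf i; lra.
by rewrite mulrCA ler_pM2l.
Qed.

End Nets.

(** * The embedding *)

Section StableMatrix.
Context d (T : measurableType d) (R : realType) (P : probability T R).
Context (p : R) (r n : nat) (X : 'I_r * 'I_n -> {RV P >-> R}).

Definition row_form (y : 'cV[R]_n) (l : 'I_r) (w : T) : R :=
  \sum_j X (l, j) w * y j 0.

Definition scaled_matrix (s : R) (w : T) : 'M[R]_(r, n) :=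
  \matrix_(i, j) (s * X (i, j) w).

Lemma scaled_matrixE (s : R) (w : T) (y : 'cV[R]_n) :
  scaled_matrix s w *m y = s *: \col_l row_form y l w.
Proof.
apply/colP => l; rewrite !mxE /row_form mulr_sumr; apply: eq_bigr => j _.
by rewrite mxE mulrA.
Qed.

Lemma measurable_row_form y l : measurable_fun [set: T] (row_form y l).
Proof. by apply: measurable_sum => j; apply: measurable_funM. Qed.

Hypothesis indX : mutually_independent X.
Hypothesis stX : forall ij, std_sym_stable p (distribution P (X ij)).

(** Stability with the coefficients [v l * y j 0]: the double sum of p-th powers factors, and [y]
    has norm 1. This is the joint characteristic function of the row forms. *)
Lemma Ex_cos_row_forms (y : 'cV[R]_n) (v : 'I_r -> R) : 1 <= p ->
  lpnorm p y = 1 ->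
  Ex P (fun w => cos (\sum_l v l * row_form y l w)) =
  expR (- \sum_l `|v l| `^ p).
Proof.
move=> p1 y1.
have := Ex_cos_sum indX stX (fun ij => v ij.1 * y ij.2 0).
have -> : (fun w => cos (\sum_i v i.1 * y i.2 0 * X i w)) =
    (fun w => cos (\sum_l v l * row_form y l w)).
  apply/funext => w; congr cos.
  rewrite (eq_bigr (fun ij => v ij.1 * y ij.2 0 * X (ij.1, ij.2) w)); last by case.
  rewrite -(pair_bigA _ (fun l j => v l * y j 0 * X (l, j) w))/=.
  by apply: eq_bigr => i _; rewrite mulr_sumr; apply: eq_bigr => j _; ring.
move=> ->; congr (expR (- _)).
rewrite -(pair_bigA _ (fun l j => `|v l * y j 0| `^ p))/=.
apply: eq_bigr => l _; under eq_bigr do rewrite normrM powRM//.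
by rewrite -mulr_sumr -lpnorm_powR// y1 powR1 mulr1.
Qed.

Lemma sum_delta_row (i : 'I_r) (s : R) (F : 'I_r -> R) :
  \sum_l (if l == i then s else 0) * F l = s * F i.
Proof.
rewrite (bigD1 i)//= eqxx big1 ?addr0// => l /negPf ->; exact: mul0r.
Qed.

Lemma Ex_cos_row_form (y : 'cV[R]_n) i (t : R) : 1 <= p -> lpnorm p y = 1 ->
  Ex P (fun w => cos (t * row_form y i w)) = expR (- (`|t| `^ p)).
Proof.
move=> p1 y1; have p0 : p != 0 by apply: lt0r_neq0; lra.
have := Ex_cos_row_forms (fun l => if l == i then t else 0) p1 y1.
under eq_fun do rewrite sum_delta_row.
move=> ->; congr (expR (- _)).
rewrite (bigD1 i)//= eqxx big1 ?addr0// => l /negPf ->.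
by rewrite normr0 powR0.
Qed.

(** The product is half the sum of cos(a + b) and cos(a - b), whose means agree because |-t| =
    |t|. *)
Lemma Ex_cosM_row_form (y : 'cV[R]_n) i j (s t : R) : 1 <= p -> lpnorm p y = 1 ->
  i != j ->
  Ex P (fun w => cos (s * row_form y i w) * cos (t * row_form y j w)) =
  expR (- (`|s| `^ p)) * expR (- (`|t| `^ p)).
Proof.
move=> p1 y1 ij; have p0 : p != 0 by apply: lt0r_neq0; lra.
have E2 (u : R) : Ex P (fun w => cos (s * row_form y i w + u * row_form y j w)) =
    expR (- (`|s| `^ p + `|u| `^ p)).
  have := Ex_cos_row_forms (fun l => (if l == i then s else 0) +
    (if l == j then u else 0)) p1 y1.
  under eq_fun => w.
    under eq_bigr do rewrite mulrDl.
    rewrite big_split/= !sum_delta_row.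
    over.
  move=> ->; congr (expR (- _)).
  have ji : j != i by rewrite eq_sym.
  rewrite (bigD1 i)//= eqxx (negPf ij) addr0 (bigD1 j)//= eqxx (negPf ji) add0r.
  rewrite big1 ?addr0// => l /andP[/negPf -> /negPf ->].
  by rewrite addr0 normr0 powR0.
have mf u : measurable_fun [set: T]
    (fun w => s * row_form y i w + u * row_form y j w).
  by apply: measurable_funD; apply: measurable_funM => //; exact: measurable_row_form.
have bc u : bounded_measurable (fun w => cos (s * row_form y i w + u * row_form y j w)).
  exact: bm_cos.
transitivity (Ex P (fun w => 2^-1 * (cos (s * row_form y i w + t * row_form y j w) +
    cos (s * row_form y i w + (- t) * row_form y j w)))).
  by congr (Ex P _); apply/funext => w; rewrite mulNr cosB cosD; field.
rewrite (ExZ P 2^-1 (bmD (bc t) (bc (- t)))) (ExD P (bc t) (bc (- t))).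
rewrite !E2 normrN opprD expRD.
by move: (expR _) (expR _) => e1 e2; field.
Qed.

End StableMatrix.

(** * Union bound over the net and distortion *)

Section Distortion.
Context (R : realType) (p : R).

Definition net_lo := sum_lo p `^ p^-1.
Definition net_hi : R := sum_hi R `^ p^-1.

Lemma sum_lo_bounds : p < 2 -> 0 < sum_lo p <= 1.
Proof.
move=> p2; have q4 := two_powR_lt4 p2.
have u8 : 8 <= cos_scales_ub p.
  by rewrite /cos_scales_ub lerDl divr_ge0//; lra.
by rewrite /sum_lo invr_gt0 invf_le1; [apply/andP; split; lra | lra].
Qed.

Lemma sum_hi_ge1 : 1 <= sum_hi R.
Proof.
have c0 := @one_sub_cos1_gt0 R; have c1 := @cos1_gt0 R.
have : 4 <= 4 / (1 - cos 1) :> R by rewrite ler_pdivlMr//; lra.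
rewrite /sum_hi; lra.
Qed.

Lemma net_bounds : 1 <= p -> p < 2 -> [/\ 0 < net_lo, net_lo <= 1 & 1 <= net_hi].
Proof.
move=> p1 p2; have /andP[lo0 lo1] := sum_lo_bounds p2.
have hi1 := sum_hi_ge1; have pi0 : 0 <= p^-1 by rewrite invr_ge0; lra.
have mono := @ge0_ler_powR R _ pi0.
have e1 : 1 `^ p^-1 = 1 :> R by rewrite powR1.
split; first exact: powR_gt0.
  by rewrite -[leRHS]e1; apply: mono; rewrite ?nnegrE//; lra.
by rewrite -[leLHS]e1; apply: mono; rewrite ?nnegrE//; lra.
Qed.

Lemma lpnorm_scaled_bounds (m : nat) (z : 'cV[R]_m) (s : R) : 1 <= p -> 0 < s ->
  0 <= sum_lo p ->
  sum_lo p * s <= \sum_i `|z i 0| `^ p <= sum_hi R * s ->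
  net_lo <= lpnorm p (s `^ (- p^-1) *: z) <= net_hi.
Proof.
move=> p1 s0 lo0 /andP[l u]; have hi1 := sum_hi_ge1.
have pi0 : 0 <= p^-1 by rewrite invr_ge0; lra.
have mono := @ge0_ler_powR R _ pi0.
have hi0 : 0 <= sum_hi R by lra.
have ss : s `^ (- p^-1) * s `^ p^-1 = 1.
  by rewrite powRN mulVf// gt_eqF// powR_gt0.
have sN0 : 0 <= s `^ (- p^-1) := powR_ge0 _ _.
rewrite lpnormZ// ger0_norm//; apply/andP; split.
  rewrite -[leLHS]mulr1 -ss mulrCA ler_wpM2l// -(powRM _ lo0 (ltW s0)).
  by apply: mono; rewrite ?nnegrE ?mulr_ge0 ?(ltW s0) ?sum_powR_ge0.
rewrite -[leRHS]mulr1 -ss mulrCA ler_wpM2l// -(powRM _ hi0 (ltW s0)).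
by apply: mono; rewrite ?nnegrE ?mulr_ge0 ?(ltW s0) ?sum_powR_ge0.
Qed.

Lemma fail_const_gt1 : 1 < fail_const R.
Proof.
have c0 := @one_sub_cos1_gt0 R.
have : 0 < 2 / (1 - cos 1) :> R by rewrite divr_gt0.
rewrite /fail_const; lra.
Qed.

(* The net has at most [h ^ d] points and each of them fails with probability
   at most [fail_const / L]. *)
Lemma stable_embedding (h d n r : nat) (A : 'M[R]_(n, d)) (dO : measure_display)
    (T : measurableType dO) (P : probability T R)
    (X : 'I_r * 'I_n -> {RV P >-> R}) (L eps : R) :
  1 <= p -> p < 2 -> (2 <= h)%N ->
  2 <= net_lo / (4 * net_hi) * (h%:R - 1) ->
  1 <= L -> expR L = r%:R -> h%:R ^+ d * (fail_const R / L) <= eps ->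
  mutually_independent X ->
  (forall ij, std_sym_stable p (distribution P (X ij))) ->
  exists E : set T, [/\ measurable E,
    forall w, E w -> forall x : 'cV[R]_d,
      let Pi := scaled_matrix X ((r%:R * L) `^ (- p^-1)) w in
      net_lo / 2 * lpnorm p (A *m x) <= lpnorm p (Pi *m (A *m x)) <=
        2 * net_hi * lpnorm p (A *m x)
  & ((1 - eps)%:E <= P E)%E].
Proof.
move=> p1 p2 h2 hd L1 rL failL indX stX.
have [lo0 lo1 hi1] := net_bounds p1 p2.
have /andP[slo0 _] := sum_lo_bounds p2.
(* [A] may have a kernel. Parametrizing its column space by a basis [B] makes [N] a norm in
   dimension [\rank A], and a left inverse of [B] yields [coordN]. *)
pose B := col_base A; pose N (x : 'cV[R]_(\rank A)) := lpnorm p (B *m x).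
have semi m (C : 'M[R]_(m, n)) :
    is_seminorm (fun x : 'cV[R]_(\rank A) => lpnorm p (C *m (B *m x))).
  split=> [x y|c x]; first by rewrite !mulmxDr; exact: lpnormD.
  by rewrite -!scalemxAr lpnormZ.
have hN : is_seminorm N.
  split=> [x y|c x]; first by rewrite /N mulmxDr; exact: lpnormD.
  by rewrite /N -scalemxAr lpnormZ.
pose c1 := \sum_i \sum_j `|pinvmx B i j|.
have coordN (x : 'cV[R]_(\rank A)) i : `|x i 0| <= c1 * N x.
  have -> : x i 0 = \sum_j pinvmx B i j * (B *m x) j 0.
    by rewrite -[in LHS](mul1mx x) -(mulVpmx (col_base_full A)) -mulmxA mxE.
  rewrite (le_trans (ler_norm_sum _ _ _))//.
  apply: (@le_trans _ _ ((\sum_j `|pinvmx B i j|) * N x)).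
    rewrite mulr_suml; apply: ler_sum => j _; rewrite normrM ler_wpM2l//.
    exact: normr_le_lpnorm.
  rewrite ler_wpM2r ?lpnorm_ge0// /c1 (bigD1 i)//= lerDl.
  by apply: sumr_ge0 => i' _; apply: sumr_ge0 => j _; exact: normr_ge0.
set delta := net_lo / (4 * net_hi) in hd.
have hi4 : 0 < 4 * net_hi by lra.
have delta0 : 0 < delta by rewrite divr_gt0.
have [M [f [Mh f1 net]]] := exists_net hN coordN h2 hd delta0.
have r1 : 1 <= r%:R :> R by have := expR_ge1Dx L; lra.
have rL0 : 0 < r%:R * L by nra.
have /choice[Bad BadP] : forall i : 'I_M, exists Bad : set T,
    [/\ measurable Bad, Ex P \1_Bad <= fail_const R / L & forall w, ~ Bad w ->
      sum_lo p * (r%:R * L) <= \sum_l `|row_form X (B *m f i) l w| `^ p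
        <= sum_hi R * (r%:R * L)].
  move=> i; apply: stable_power_sum => //.
  - by move=> l; exact: measurable_row_form.
  - by move=> l t; apply: Ex_cos_row_form => //; exact: f1.
  - by move=> l l' s t ll'; apply: Ex_cosM_row_form => //; exact: f1.
pose U := \bigcup_(i in [set: 'I_M]) Bad i.
have mB i : measurable (Bad i) by have [] := BadP i.
have mU : measurable U by apply: fin_bigcup_measurable.
have PU : fine (P U) <= eps.
  rewrite -Ex_indic//.
  have bB i := bm_indic R (mB i).
  apply: (@le_trans _ _ (Ex P (fun w => \sum_(i < M) \1_(Bad i) w))).
    apply: le_Ex => [||w]; [exact: bm_indic|exact: bm_sum|].
    rewrite indicE; case: (boolP (w \in _)) => [|_]; last by apply: sumr_ge0.
    rewrite inE => -[i _ Bi]; rewrite (bigD1 i)//= indicE mem_set// lerDl.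
    by apply: sumr_ge0.
  rewrite Ex_sum//; apply: le_trans failL.
  apply: (@le_trans _ _ (\sum_(i < M) fail_const R / L)).
    by apply: ler_sum => i _; have [] := BadP i.
  rewrite sumr_const card_ord -[leLHS]mulr_natl ler_wpM2r//.
    by rewrite divr_ge0//; have := fail_const_gt1; lra.
  (* The net lives in dimension [\rank A], which is at most [d]. *)
  apply: (@le_trans _ _ (h ^ \rank A)%:R); first by rewrite ler_nat.
  rewrite natrX; apply: ler_weXn2l; last exact: rank_leq_col.
  by rewrite ler1n; exact: leq_trans h2.
exists (~` U); split; first exact: measurableC.
- move=> w nU x /=; set Pi := scaled_matrix X _ w.
  have good i : net_lo <= lpnorm p (Pi *m (B *m f i)) <= net_hi.
    have [_ _ /(_ w)] := BadP i.
    have nB : ~ Bad i w by move=> Bi; apply: nU; exists i.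
    move=> /(_ nB) sb.
    rewrite /Pi scaled_matrixE.
    apply: lpnorm_scaled_bounds => //; first exact: ltW.
    by under eq_bigr do rewrite mxE.
  have dab : delta * (4 * net_hi) <= net_lo by rewrite /delta divfK// gt_eqF.
  have d2 : delta <= 2^-1 by rewrite /delta ler_pdivrMr//; lra.
  have hi0 : 0 <= net_hi by lra.
  have -> : A *m x = B *m (row_base A *m x) by rewrite mulmxA mulmx_base.
  exact: (net_extension hN coordN (semi _ Pi) f1 net (ltW lo0) hi0 d2 dab good).
- rewrite probability_setC// -[P U]fineK ?fin_num_measure//.
  by rewrite -EFinB lee_fin lerB.
Qed.

End Distortion.

Theorem theorem2 (R : realType) (p : R) (hp1 : 1 <= p) (hp2 : p < 2) :
  exists (c kappa a b : R),
    [/\ 0 < c, 1 <= kappa, 0 < a, a <= b & b / a <= kappa] /\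
    forall (d n r : nat), (1 <= d)%N -> (1 <= n)%N ->
      (r%:Z = Num.ceil (expR (expR (c * d%:R)))) ->
      forall (A : 'M[R]_(n, d)) (dO : measure_display) (Omega : measurableType dO)
        (P : probability Omega R) (X : 'I_r * 'I_n -> {RV P >-> R}),
        mutually_independent X ->
        (forall ij, std_sym_stable p (distribution P (X ij))) ->
        let Pi := fun w : Omega =>
          \matrix_(i < r, j < n) ((r%:R * ln r%:R) `^ (- p^-1) * X (i, j) w) in
        exists E : set Omega,
          [/\ measurable E,
              E `<=` [set w | forall x : 'cV[R]_d,
                  a * lpnorm p (A *m x) <= lpnorm p (Pi w *m (A *m x)) /\
                  lpnorm p (Pi w *m (A *m x)) <= b * lpnorm p (A *m x)]
            & ((99%:R / 100%:R)%:E <= P E)%E].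
Proof.
have [lo0 lo1 hi1] := net_bounds hp1 hp2.
have f1 := fail_const_gt1 R.
(* With delta = net_lo / (4 net_hi), the offset 2 gives h - 1 > 2 / delta and h >= 2 at once. *)
pose h := (Num.truncn (2 / (net_lo p / (4 * net_hi p)))).+2.
have delta0 : 0 < net_lo p / (4 * net_hi p) by rewrite divr_gt0//; lra.
have hd : 2 <= net_lo p / (4 * net_hi p) * (h%:R - 1).
  rewrite mulrC -ler_pdivrMr// /h -[X in X - 1]natr1 addrK.
  exact/ltW/truncnS_gt.
have h2 : (2 <= h)%N by [].
(* With c = ln K the assumption on [r] gives ln r >= K^d. As [d >= 1], K^d is at least 100
   fail_const h^d, so the union bound h^d fail_const / ln r is at most 1/100. *)
pose K : R := 100 * fail_const R * h%:R.
have h2' : 2 <= h%:R :> R by rewrite ler_nat.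
have K1 : 1 < K by rewrite /K; nra.
have K0 : 0 < K by lra.
have ab : net_lo p / 2 <= 2 * net_hi p by lra.
have a0 : 0 < net_lo p / 2 by lra.
exists (ln K), (2 * net_hi p / (net_lo p / 2)), (net_lo p / 2), (2 * net_hi p).
split; first by split => //; [exact: ln_gt0 | rewrite ler_pdivlMr// mul1r].
move=> d n r d1 _ hr A dO Omega P X indX stX Pi.
have KE : expR (ln K * d%:R) = K ^+ d by rewrite expRM_natr lnK.
have r_ge : expR (K ^+ d) <= r%:R.
  by have := ceil_ge (expR (K ^+ d)); rewrite -KE -hr.
have r0 : 0 < r%:R :> R by rewrite (lt_le_trans _ r_ge)// expR_gt0.
have KL : K ^+ d <= ln r%:R by rewrite -ler_expR lnK.
have K_ge : K <= K ^+ d by rewrite ler_eXnr// ltW.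
have L1 : 1 <= ln r%:R :> R by lra.
have failL : h%:R ^+ d * (fail_const R / ln r%:R) <= 1 / 100.
  have f0 : 1 <= 100 * fail_const R by lra.
  have fd : 100 * fail_const R <= (100 * fail_const R) ^+ d by rewrite ler_eXnr.
  have hd0 : 0 <= h%:R ^+ d :> R by rewrite exprn_ge0.
  rewrite mulrA ler_pdivrMr; last by lra.
  have : h%:R ^+ d * (100 * fail_const R) <= K ^+ d.
    by rewrite /K exprMn mulrC ler_wpM2r.
  lra.
have rE : expR (ln r%:R) = r%:R :> R by rewrite lnK.
have [E [mE EP PE]] := stable_embedding A hp1 hp2 h2 hd L1 rE failL indX stX.
exists E; split => //.
  by move=> w /EP Ew x; have /andP[] := Ew x.
by apply: le_trans PE; rewrite lee_fin; lra.
Qed.
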